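(* Let $\Bbbk$ be a field and let $\langle C,\succ,\perp\rangle$ be a postcommutative algebra over $\Bbbk$ with linear basis $B$. Then the set of all $E$-words (defined in the context from $B$) forms a linear basis of the universal enveloping commutative Rota–Baxter algebra of unit weight $U_{\mathrm{RB}}(C)$ of $C$; that is, the images of the $E$-words under the canonical homomorphism from the free commutative Rota–Baxter algebra of weight $1$ generated by $B$ onto $U_{\mathrm{RB}}(C)$ are pairwise distinct and form a basis of the vector space $U_{\mathrm{RB}}(C)$.
   Context: All algebras are over a field $\Bbbk$ and are not assumed to have a unit; ''commutative algebra'' means commutative and associative algebra. A linear operator $R$ on an algebra $A$ is a Rota–Baxter operator (RB-operator) of weight $1$ (unit weight) if $R(x)R(y)=R(R(x)y+xR(y)+xy)$ for all $x,y\in A$. A commutative RB-algebra is a commutative algebra with an RB-operator. A postcommutative algebra is a vector space with two bilinear products $\succ,\perp$ such that $\perp$ is associative and commutative and $(x\succ y+y\succ x+x\perp y)\succ z=x\succ(y\succ z)$, $x\succ(y\perp z)=(x\succ y)\perp z$, $(x\succ y)\perp z=y\perp(x\succ z)$. If $U$ is a commutative algebra with an RB-operator $R$ of weight $1$, then $U^{(R)}$ denotes the space $U$ with the products $x\succ y=R(x)y$ and $x\perp y=xy$; it is a postcommutative algebra. The universal enveloping commutative RB-algebra $U_{\mathrm{RB}}(C)$ of a postcommutative algebra $C$ is the universal commutative RB-algebra $U$ of weight $1$ equipped with a homomorphism $C\to U^{(R)}$ of postcommutative algebras; equivalently, for a linear basis $B$ of $C$ it is the quotient of the free commutative RB-algebra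 of weight $1$ generated by $B$ by the relations $R(b)a=b\succ a$, $ab=a\perp b$ for $a,b\in B$, where the right-hand sides stand for the linear combinations of elements of $B$ equal to the products in $C$. Standard base of the free commutative RB-algebra generated by $B$: the smallest set $T$ of words such that all nonempty commutative monomials in $B$ lie in $T$, and if $u\in T$ then $R(u)\in T$ and $R(u)w\in T$ for every nonempty commutative monomial $w$ in $B$. $E$-words are the elements of the standard base defined inductively by: (1) elements of $B$ are $E$-words of type 1; (2) if $u$ is an $E$-word, then $R(u)$ is an $E$-word of type 2; (3) if $x$ is an $E$-word and $a\in B$, then $R^2(x)a=R(R(x))a$ is an $E$-word of type 3. *)

(* Defs.v *)
From HB Require Import structures.
From mathcomp Require Import all_boot all_order all_algebra finmap multiset.
From mathcomp Require Import boolp classical_sets functions.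

Set Implicit Arguments.
Unset Strict Implicit.
Unset Printing Implicit Defensive.

Import GRing.Theory.
Local Open Scope ring_scope.
Local Open Scope quotient_scope.
Local Open Scope classical_set_scope.

(* Algebras are not unital, so they are built directly on lmodType rather than
   on MathComp's (unital) ring structures. *)

HB.mixin Record isCommRBAlg (k : fieldType) V of GRing.Lmodule k V := {
  rbmul : V -> V -> V;
  rbop : V -> V;
  rbmul_linear : forall x, linear (rbmul x);
  rbmulC : commutative rbmul;
  rbmulA : associative rbmul;
  rbop_linear : linear rbop;
  rbopM : forall x y, rbmul (rbop x) (rbop y)
    = rbop (rbmul (rbop x) y + rbmul x (rbop y) + rbmul x y)
}.

#[short(type="commRBAlgType")]
HB.structure Definition CommRBAlg (k : fieldType) :=
  { V of isCommRBAlg k V & GRing.Lmodule k V }.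

HB.mixin Record isPostCommAlg (k : fieldType) V of GRing.Lmodule k V := {
  psucc : V -> V -> V;
  pperp : V -> V -> V;
  psucc_linearr : forall x, linear (psucc x);
  psucc_linearl : forall y, linear (psucc^~ y);
  pperp_linear : forall x, linear (pperp x);
  pperpC : commutative pperp;
  pperpA : associative pperp;
  psuccA : forall x y z,
    psucc (psucc x y + psucc y x + pperp x y) z = psucc x (psucc y z);
  psucc_perp : forall x y z, psucc x (pperp y z) = pperp (psucc x y) z;
  pperp_succ : forall x y z, pperp (psucc x y) z = pperp y (psucc x z)
}.

#[short(type="postCommAlgType")]
HB.structure Definition PostCommAlg (k : fieldType) :=
  { V of isPostCommAlg k V & GRing.Lmodule k V }.

Section Morphisms.
Variable k : fieldType.

Definition rb_hom (A A' : commRBAlgType k) (f : A -> A') : Prop :=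
  [/\ linear f, {morph f : x y / rbmul x y} & {morph f : x / rbop x}].

Definition post_hom (C C' : postCommAlgType k) (f : C -> C') : Prop :=
  [/\ linear f, {morph f : x y / psucc x y} & {morph f : x y / pperp x y}].

Lemma linear_sum (V W : lmodType k) (f : V -> W) : linear f ->
  forall (J : Type) (s : seq J) (c : J -> k) (v : J -> V),
  f (\sum_(i <- s) c i *: v i) = \sum_(i <- s) c i *: f (v i).
Proof.
move=> fl J s c v; have f0 : f 0 = 0.
  by have := fl (-1) 0 0; rewrite scaler0 addr0 scaleN1r addNr.
elim: s => [|i s IHs]; first by rewrite !big_nil.
by rewrite !big_cons fl IHs.
Qed.

Lemma linear_comp (V W Z : lmodType k) (f : V -> W) (g : W -> Z) :
  linear f -> linear g -> linear (g \o f).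
Proof. by move=> fl gl a x y /=; rewrite fl gl. Qed.

End Morphisms.

Section BilinearTheory.
Variables (k : fieldType) (A : commRBAlgType k).
Implicit Types x y z : A.

Lemma rbmulDr x y z : rbmul x (y + z) = rbmul x y + rbmul x z.
Proof. by have := rbmul_linear x 1 y z; rewrite !scale1r. Qed.

Lemma rbmulDl x y z : rbmul (x + y) z = rbmul x z + rbmul y z.
Proof. by rewrite rbmulC rbmulDr !(rbmulC z). Qed.

Lemma rbmul0r x : rbmul x 0 = 0.
Proof. by apply: (addrI (rbmul x 0)); rewrite -rbmulDr !addr0. Qed.

Lemma rbmulZr a x y : rbmul x (a *: y) = a *: rbmul x y.
Proof. by have := rbmul_linear x a y 0; rewrite rbmul0r !addr0. Qed.

Lemma rbmulZl a x y : rbmul (a *: x) y = a *: rbmul x y.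
Proof. by rewrite rbmulC rbmulZr rbmulC. Qed.

Lemma rbmulBr x y z : rbmul x (y - z) = rbmul x y - rbmul x z.
Proof. by rewrite rbmulDr -scaleN1r rbmulZr scaleN1r. Qed.

Lemma rbmulBl x y z : rbmul (x - y) z = rbmul x z - rbmul y z.
Proof. by rewrite rbmulC rbmulBr !(rbmulC z). Qed.

Lemma rbopD x y : rbop (x + y) = rbop x + rbop y.
Proof. by have := rbop_linear 1 x y; rewrite !scale1r. Qed.

Lemma rbop0 : rbop (0 : A) = 0.
Proof. by apply: (addrI (rbop (0 : A))); rewrite -rbopD !addr0. Qed.

Lemma rbopZ a x : rbop (a *: x) = a *: rbop x.
Proof. by have := rbop_linear a x 0; rewrite rbop0 !addr0. Qed.

Lemma rbopB x y : rbop (x - y) = rbop x - rbop y.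
Proof. by rewrite rbopD -scaleN1r rbopZ scaleN1r. Qed.

End BilinearTheory.

(* rbpost U is the postcommutative algebra U^(R). *)
Definition rbpost (k : fieldType) (U : commRBAlgType k) : Type := U.

Section RBPost.
Variables (k : fieldType) (U : commRBAlgType k).

HB.instance Definition _ := GRing.Lmodule.on (rbpost U).

Let succ (x y : rbpost U) : rbpost U := rbmul (rbop (x : U)) (y : U).
Let perp (x y : rbpost U) : rbpost U := rbmul (x : U) (y : U).

Let succ_linearr x : linear (succ x).
Proof. exact: rbmul_linear. Qed.

Let succ_linearl y : linear (succ^~ y).
Proof.
by move=> a u v; rewrite /succ rbop_linear rbmulDl rbmulZl.
Qed.

Let perp_linear x : linear (perp x).
Proof. exact: rbmul_linear. Qed.

Let perpC : commutative perp.
Proof. exact: rbmulC. Qed.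

Let perpA : associative perp.
Proof. exact: rbmulA. Qed.

Let succA x y z : succ (succ x y + succ y x + perp x y) z = succ x (succ y z).
Proof. by rewrite /succ /perp rbmulA rbopM (rbmulC x (rbop y)). Qed.

Let succ_perp x y z : succ x (perp y z) = perp (succ x y) z.
Proof. exact: rbmulA. Qed.

Let perp_succ x y z : perp (succ x y) z = perp y (succ x z).
Proof. by rewrite /perp /succ (rbmulC _ y) rbmulA. Qed.

HB.instance Definition _ := isPostCommAlg.Build k (rbpost U)
  succ_linearr succ_linearl perp_linear perpC perpA succA succ_perp perp_succ.

End RBPost.

(* The free commutative RB-algebra: terms modulo the congruence generated by
   the axioms. *)

Inductive rbterm (k : fieldType) (I : Type) : Type :=
| TGen of I
| TZero
| TAdd of rbterm k I & rbterm k I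
| TScale of k & rbterm k I
| TMul of rbterm k I & rbterm k I
| TOp of rbterm k I.

Arguments TGen {k I}.
Arguments TZero {k I}.

HB.instance Definition _ k I := gen_eqMixin (rbterm k I).
HB.instance Definition _ k I := gen_choiceMixin (rbterm k I).

Inductive rbterm_eq (k : fieldType) (I : Type) :
    rbterm k I -> rbterm k I -> Prop :=
| TErefl t : rbterm_eq t t
| TEsym t u : rbterm_eq t u -> rbterm_eq u t
| TEtrans t u v : rbterm_eq t u -> rbterm_eq u v -> rbterm_eq t v
| TEAdd t t' u u' :
    rbterm_eq t t' -> rbterm_eq u u' -> rbterm_eq (TAdd t u) (TAdd t' u')
| TEScale a t t' : rbterm_eq t t' -> rbterm_eq (TScale a t) (TScale a t')
| TEMul t t' u u' :
    rbterm_eq t t' -> rbterm_eq u u' -> rbterm_eq (TMul t u) (TMul t' u')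
| TEOp t t' : rbterm_eq t t' -> rbterm_eq (TOp t) (TOp t')
| TEaddA t u v : rbterm_eq (TAdd t (TAdd u v)) (TAdd (TAdd t u) v)
| TEaddC t u : rbterm_eq (TAdd t u) (TAdd u t)
| TEadd0 t : rbterm_eq (TAdd TZero t) t
| TEaddN t : rbterm_eq (TAdd (TScale (- 1) t) t) TZero
| TEscaleA a b t : rbterm_eq (TScale a (TScale b t)) (TScale (a * b) t)
| TEscale1 t : rbterm_eq (TScale 1 t) t
| TEscaleDr a t u :
    rbterm_eq (TScale a (TAdd t u)) (TAdd (TScale a t) (TScale a u))
| TEscaleDl a b t :
    rbterm_eq (TScale (a + b) t) (TAdd (TScale a t) (TScale b t))
| TEmulC t u : rbterm_eq (TMul t u) (TMul u t)
| TEmulA t u v : rbterm_eq (TMul t (TMul u v)) (TMul (TMul t u) v)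
| TEmul_lin t a u v :
    rbterm_eq (TMul t (TAdd (TScale a u) v))
              (TAdd (TScale a (TMul t u)) (TMul t v))
| TEop_lin a u v :
    rbterm_eq (TOp (TAdd (TScale a u) v)) (TAdd (TScale a (TOp u)) (TOp v))
| TEopM t u :
    rbterm_eq (TMul (TOp t) (TOp u))
      (TOp (TAdd (TAdd (TMul (TOp t) u) (TMul t (TOp u))) (TMul t u))).

Section FreeRB.
Variables (k : fieldType) (I : Type).

Definition rbterm_eqb (t u : rbterm k I) : bool := `[< rbterm_eq t u >].

Lemma rbterm_eqb_equiv : equiv_class_of rbterm_eqb.
Proof.
split=> [t|t u|u t v]; first by apply/asboolP; exact: TErefl.
  by apply/asboolP/asboolP; exact: TEsym.
move=> /asboolP tu /asboolP uv; apply/asboolP; exact: TEtrans tu uv.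
Qed.

Canonical rbterm_equiv := EquivRelPack rbterm_eqb_equiv.
Canonical rbterm_encModRel := defaultEncModRel rbterm_eqb.

Definition freeRB : Type := {eq_quot rbterm_eqb}.

HB.instance Definition _ : EqQuotient _ rbterm_eqb freeRB :=
  EqQuotient.on freeRB.
HB.instance Definition _ := Choice.on freeRB.

Definition freeRB_class (t : rbterm k I) : freeRB := \pi_freeRB t.

Lemma freeRB_eqP (t u : rbterm k I) :
  freeRB_class t = freeRB_class u <-> rbterm_eq t u.
Proof. by split=> [/eqmodP/asboolP|tu] //; apply/eqmodP/asboolP. Qed.

Lemma freeRB_repr (t : rbterm k I) : rbterm_eq (repr (freeRB_class t)) t.
Proof. by apply/freeRB_eqP; rewrite /freeRB_class reprK. Qed.

Lemma freeRB_surj (P : freeRB -> Prop) :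
  (forall t, P (freeRB_class t)) -> forall x, P x.
Proof. by move=> PP; elim/quotW=> t; exact: PP. Qed.

Definition freeRB_gen (i : I) : freeRB := freeRB_class (TGen i).

Let zero : freeRB := freeRB_class TZero.
Let add (x y : freeRB) : freeRB := freeRB_class (TAdd (repr x) (repr y)).
Let opp (x : freeRB) : freeRB := freeRB_class (TScale (- 1) (repr x)).
Let scale (a : k) (x : freeRB) : freeRB := freeRB_class (TScale a (repr x)).
Let mul (x y : freeRB) : freeRB := freeRB_class (TMul (repr x) (repr y)).
Let op (x : freeRB) : freeRB := freeRB_class (TOp (repr x)).

Let addE t u : add (freeRB_class t) (freeRB_class u) = freeRB_class (TAdd t u).
Proof. by apply/freeRB_eqP/TEAdd; exact: freeRB_repr. Qed.
Let oppE t : opp (freeRB_class t) = freeRB_class (TScale (- 1) t).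
Proof. by apply/freeRB_eqP/TEScale; exact: freeRB_repr. Qed.
Let scaleE a t : scale a (freeRB_class t) = freeRB_class (TScale a t).
Proof. by apply/freeRB_eqP/TEScale; exact: freeRB_repr. Qed.
Let mulE t u : mul (freeRB_class t) (freeRB_class u) = freeRB_class (TMul t u).
Proof. by apply/freeRB_eqP/TEMul; exact: freeRB_repr. Qed.
Let opE t : op (freeRB_class t) = freeRB_class (TOp t).
Proof. by apply/freeRB_eqP/TEOp; exact: freeRB_repr. Qed.

Let addA : associative add.
Proof.
elim/freeRB_surj=> x; elim/freeRB_surj=> y; elim/freeRB_surj=> z; rewrite !addE.
exact/freeRB_eqP/TEaddA.
Qed.
Let addC : commutative add.
Proof. by elim/freeRB_surj=> x; elim/freeRB_surj=> y; rewrite !addE; exact/freeRB_eqP/TEaddC. Qed.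
Let add0 : left_id zero add.
Proof. by elim/freeRB_surj=> x; rewrite !addE; exact/freeRB_eqP/TEadd0. Qed.
Let addN : left_inverse zero opp add.
Proof. by elim/freeRB_surj=> x; rewrite !oppE !addE; exact/freeRB_eqP/TEaddN. Qed.

HB.instance Definition _ := GRing.isZmodule.Build freeRB addA addC add0 addN.

Let scaleA a b v : scale a (scale b v) = scale (a * b) v.
Proof. by elim/freeRB_surj: v => v; rewrite !scaleE; exact/freeRB_eqP/TEscaleA. Qed.
Let scale1 : left_id 1 scale.
Proof. by elim/freeRB_surj=> v; rewrite !scaleE; exact/freeRB_eqP/TEscale1. Qed.
Let scaleDr : right_distributive scale +%R.
Proof.
move=> a; elim/freeRB_surj=> u; elim/freeRB_surj=> v; rewrite -[RHS]/(add _ _).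
by rewrite -[_ + _]/(add _ _) !(scaleE, addE); exact/freeRB_eqP/TEscaleDr.
Qed.
Let scaleDl v : {morph scale^~ v : a b / a + b}.
Proof.
elim/freeRB_surj: v => v a b; rewrite -[RHS]/(add _ _) !(scaleE, addE).
exact/freeRB_eqP/TEscaleDl.
Qed.

HB.instance Definition _ :=
  GRing.Zmodule_isLmodule.Build k freeRB scaleA scale1 scaleDr scaleDl.

Let mul_linear x : linear (mul x).
Proof.
move=> a u v; rewrite -[RHS]/(add (scale _ _) _) -[_ + _]/(add (scale _ _) _).
elim/freeRB_surj: x => x; elim/freeRB_surj: u => u; elim/freeRB_surj: v => v.
rewrite !(scaleE, addE, mulE); exact/freeRB_eqP/TEmul_lin.
Qed.
Let mulC : commutative mul.
Proof. by elim/freeRB_surj=> x; elim/freeRB_surj=> y; rewrite !mulE; exact/freeRB_eqP/TEmulC. Qed.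
Let mulA : associative mul.
Proof.
elim/freeRB_surj=> x; elim/freeRB_surj=> y; elim/freeRB_surj=> z; rewrite !mulE.
exact/freeRB_eqP/TEmulA.
Qed.
Let op_linear : linear op.
Proof.
move=> a u v; rewrite -[RHS]/(add (scale _ _) _) -[_ + _]/(add (scale _ _) _).
elim/freeRB_surj: u => u; elim/freeRB_surj: v => v.
rewrite !(scaleE, addE, opE); exact/freeRB_eqP/TEop_lin.
Qed.
Let opM x y : mul (op x) (op y) = op (mul (op x) y + mul x (op y) + mul x y).
Proof.
rewrite -[_ + _ + _]/(add (add _ _) _); elim/freeRB_surj: x => x; elim/freeRB_surj: y => y.
rewrite (opE x) (opE y) !mulE 2!addE opE; exact/freeRB_eqP/TEopM.
Qed.

HB.instance Definition _ := isCommRBAlg.Build k freeRB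
  mul_linear mulC mulA op_linear opM.

Lemma freeRB_addE t u :
  freeRB_class t + freeRB_class u = freeRB_class (TAdd t u).
Proof. exact: addE. Qed.
Lemma freeRB_scaleE a t : a *: freeRB_class t = freeRB_class (TScale a t).
Proof. exact: scaleE. Qed.
Lemma freeRB_mulE t u :
  rbmul (freeRB_class t) (freeRB_class u) = freeRB_class (TMul t u).
Proof. exact: mulE. Qed.
Lemma freeRB_opE t : rbop (freeRB_class t) = freeRB_class (TOp t).
Proof. exact: opE. Qed.

End FreeRB.

Section FreeUniversal.
Variables (k : fieldType) (I : Type) (A : commRBAlgType k) (g : I -> A).

Fixpoint rbterm_eval (t : rbterm k I) : A :=
  match t with
  | TGen i => g i
  | TZero => 0
  | TAdd t u => rbterm_eval t + rbterm_eval u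
  | TScale a t => a *: rbterm_eval t
  | TMul t u => rbmul (rbterm_eval t) (rbterm_eval u)
  | TOp t => rbop (rbterm_eval t)
  end.

Lemma rbterm_eval_eq t u : rbterm_eq t u -> rbterm_eval t = rbterm_eval u.
Proof.
elim=> //= {t u}; try by move=> *; congruence.
- by move=> *; rewrite addrA.
- by move=> *; rewrite addrC.
- by move=> *; rewrite add0r.
- by move=> *; rewrite scaleN1r addNr.
- by move=> *; rewrite scalerA.
- by move=> *; rewrite scale1r.
- by move=> *; rewrite scalerDr.
- by move=> *; rewrite scalerDl.
- by move=> *; rewrite rbmulC.
- by move=> *; rewrite rbmulA.
- by move=> *; rewrite rbmul_linear.
- by move=> *; rewrite rbop_linear.
- by move=> *; rewrite rbopM.
Qed.

Definition freeRB_lift (x : freeRB k I) : A := rbterm_eval (repr x).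

Lemma freeRB_liftE t : freeRB_lift (freeRB_class t) = rbterm_eval t.
Proof. exact/rbterm_eval_eq/freeRB_repr. Qed.

Lemma freeRB_lift_hom : rb_hom freeRB_lift.
Proof.
split=> [a x y|x y|x].
- elim/freeRB_surj: x => x; elim/freeRB_surj: y => y.
  by rewrite freeRB_scaleE freeRB_addE !freeRB_liftE.
- elim/freeRB_surj: x => x; elim/freeRB_surj: y => y.
  by rewrite freeRB_mulE !freeRB_liftE.
- by elim/freeRB_surj: x => x; rewrite freeRB_opE !freeRB_liftE.
Qed.

Lemma freeRB_lift_gen i : freeRB_lift (freeRB_gen k i) = g i.
Proof. exact: freeRB_liftE. Qed.

Lemma freeRB_lift_unique (h : freeRB k I -> A) :
  rb_hom h -> (forall i, h (freeRB_gen k i) = g i) -> h =1 freeRB_lift.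
Proof.
move=> [hl hm hr] hg; have h0 : h 0 = 0.
  have := hl (-1) 0 0; rewrite scaler0 addr0 scaleN1r addNr; exact.
have hD x y : h (x + y) = h x + h y by have := hl 1 x y; rewrite !scale1r.
have hZ a x : h (a *: x) = a *: h x by have := hl a x 0; rewrite h0 !addr0.
elim/freeRB_surj=> t; rewrite freeRB_liftE; elim: t => /=.
- exact: hg.
- exact: h0.
- by move=> t IHt u IHu; rewrite -freeRB_addE hD IHt IHu.
- by move=> a t IHt; rewrite -freeRB_scaleE hZ IHt.
- by move=> t IHt u IHu; rewrite -freeRB_mulE hm IHt IHu.
- by move=> t IHt; rewrite -freeRB_opE hr IHt.
Qed.

End FreeUniversal.

Section RBQuotient.
Variables (k : fieldType) (A : commRBAlgType k) (S : set A).

Inductive rb_ideal : A -> Prop :=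
| RBIgen x : S x -> rb_ideal x
| RBI0 : rb_ideal 0
| RBIlin a x y : rb_ideal x -> rb_ideal y -> rb_ideal (a *: x + y)
| RBImul x y : rb_ideal y -> rb_ideal (rbmul x y)
| RBIop x : rb_ideal x -> rb_ideal (rbop x).

Definition rb_equivb (x y : A) : bool := `[< rb_ideal (x - y) >].

Lemma rb_idealD x y : rb_ideal x -> rb_ideal y -> rb_ideal (x + y).
Proof. by move=> Ix Iy; rewrite -[x]scale1r; exact: RBIlin. Qed.

Lemma rb_idealZ a x : rb_ideal x -> rb_ideal (a *: x).
Proof. by move=> Ix; rewrite -[_ *: _]addr0; apply: RBIlin => //; exact: RBI0. Qed.

Lemma rb_equivb_equiv : equiv_class_of rb_equivb.
Proof.
have symm x y : rb_ideal (x - y) -> rb_ideal (y - x).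
  by move=> /(rb_idealZ (-1)); rewrite scaleN1r opprB.
split=> [x|x y|y x z]; first by apply/asboolP; rewrite subrr; exact: RBI0.
  by apply/asboolP/asboolP; exact: symm.
move=> /asboolP xy /asboolP yz; apply/asboolP.
by rewrite -[x](subrK y) -addrA; exact: rb_idealD.
Qed.

Canonical rb_equiv := EquivRelPack rb_equivb_equiv.
Canonical rb_encModRel := defaultEncModRel rb_equivb.

(* The quotient of A by the smallest RB-ideal containing S. *)
Definition rb_quot : Type := {eq_quot rb_equivb}.

HB.instance Definition _ : EqQuotient _ rb_equivb rb_quot :=
  EqQuotient.on rb_quot.
HB.instance Definition _ := Choice.on rb_quot.

Definition rb_proj (x : A) : rb_quot := \pi_rb_quot x.

Lemma rb_projP x y : rb_proj x = rb_proj y <-> rb_ideal (x - y).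
Proof. by split=> [/eqmodP/asboolP|xy] //; apply/eqmodP/asboolP. Qed.

Lemma rb_proj_repr x : rb_ideal (repr (rb_proj x) - x).
Proof. by apply/rb_projP; rewrite /rb_proj reprK. Qed.

Lemma rb_proj_surj (P : rb_quot -> Prop) :
  (forall x, P (rb_proj x)) -> forall x, P x.
Proof. by move=> PP; elim/quotW=> x; exact: PP. Qed.

Let zero : rb_quot := rb_proj 0.
Let add (x y : rb_quot) : rb_quot := rb_proj (repr x + repr y).
Let opp (x : rb_quot) : rb_quot := rb_proj (- repr x).
Let scale (a : k) (x : rb_quot) : rb_quot := rb_proj (a *: repr x).
Let mul (x y : rb_quot) : rb_quot := rb_proj (rbmul (repr x) (repr y)).
Let op (x : rb_quot) : rb_quot := rb_proj (rbop (repr x)).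

Let addE x y : add (rb_proj x) (rb_proj y) = rb_proj (x + y).
Proof.
by apply/rb_projP; rewrite opprD addrACA; apply: rb_idealD; exact: rb_proj_repr.
Qed.
Let oppE x : opp (rb_proj x) = rb_proj (- x).
Proof.
apply/rb_projP; rewrite -opprD -scaleN1r.
by apply: rb_idealZ; exact: rb_proj_repr.
Qed.
Let scaleE a x : scale a (rb_proj x) = rb_proj (a *: x).
Proof.
by apply/rb_projP; rewrite -scalerBr; apply: rb_idealZ; exact: rb_proj_repr.
Qed.
Let mulE x y : mul (rb_proj x) (rb_proj y) = rb_proj (rbmul x y).
Proof.
apply/rb_projP; set x' := repr _; set y' := repr _.
have -> : rbmul x' y' - rbmul x y = rbmul x' (y' - y) + rbmul y (x' - x).
  by rewrite !rbmulBr !(rbmulC y) subrKA.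
by apply: rb_idealD; apply: RBImul; exact: rb_proj_repr.
Qed.
Let opE x : op (rb_proj x) = rb_proj (rbop x).
Proof.
by apply/rb_projP; rewrite -rbopB; apply: RBIop; exact: rb_proj_repr.
Qed.

Let addA : associative add.
Proof.
elim/rb_proj_surj=> x; elim/rb_proj_surj=> y; elim/rb_proj_surj=> z.
by rewrite !addE addrA.
Qed.
Let addC : commutative add.
Proof. by elim/rb_proj_surj=> x; elim/rb_proj_surj=> y; rewrite !addE addrC. Qed.
Let add0 : left_id zero add.
Proof. by elim/rb_proj_surj=> x; rewrite addE add0r. Qed.
Let addN : left_inverse zero opp add.
Proof. by elim/rb_proj_surj=> x; rewrite oppE addE addNr. Qed.

HB.instance Definition _ := GRing.isZmodule.Build rb_quot addA addC add0 addN.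

Let scaleA a b v : scale a (scale b v) = scale (a * b) v.
Proof. by elim/rb_proj_surj: v => v; rewrite !scaleE scalerA. Qed.
Let scale1 : left_id 1 scale.
Proof. by elim/rb_proj_surj=> v; rewrite scaleE scale1r. Qed.
Let scaleDr : right_distributive scale +%R.
Proof.
move=> a; elim/rb_proj_surj=> u; elim/rb_proj_surj=> v.
rewrite -[RHS]/(add _ _) -[_ + _]/(add _ _) addE !scaleE addE.
by rewrite scalerDr.
Qed.
Let scaleDl v : {morph scale^~ v : a b / a + b}.
Proof.
elim/rb_proj_surj: v => v a b; rewrite -[RHS]/(add _ _) !scaleE addE.
by rewrite scalerDl.
Qed.

HB.instance Definition _ :=
  GRing.Zmodule_isLmodule.Build k rb_quot scaleA scale1 scaleDr scaleDl.

Let mul_linear x : linear (mul x).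
Proof.
move=> a u v; rewrite -[RHS]/(add (scale _ _) _) -[_ + _]/(add (scale _ _) _).
elim/rb_proj_surj: x => x; elim/rb_proj_surj: u => u.
elim/rb_proj_surj: v => v.
by rewrite !(scaleE, addE, mulE) rbmul_linear.
Qed.
Let mulC : commutative mul.
Proof. by elim/rb_proj_surj=> x; elim/rb_proj_surj=> y; rewrite !mulE rbmulC. Qed.
Let mulA : associative mul.
Proof.
elim/rb_proj_surj=> x; elim/rb_proj_surj=> y; elim/rb_proj_surj=> z.
by rewrite !mulE rbmulA.
Qed.
Let op_linear : linear op.
Proof.
move=> a u v; rewrite -[RHS]/(add (scale _ _) _) -[_ + _]/(add (scale _ _) _).
elim/rb_proj_surj: u => u; elim/rb_proj_surj: v => v.
by rewrite !(scaleE, addE, opE) rbop_linear.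
Qed.
Let opM x y : mul (op x) (op y) = op (mul (op x) y + mul x (op y) + mul x y).
Proof.
rewrite -[_ + _ + _]/(add (add _ _) _).
elim/rb_proj_surj: x => x; elim/rb_proj_surj: y => y.
by rewrite (opE x) (opE y) !mulE 2!addE opE rbopM.
Qed.

HB.instance Definition _ := isCommRBAlg.Build k rb_quot
  mul_linear mulC mulA op_linear opM.

Lemma rb_proj_hom : rb_hom rb_proj.
Proof.
split=> [a x y|x y|x]; last by rewrite -opE.
  by rewrite -addE -scaleE.
by rewrite -mulE.
Qed.

End RBQuotient.

Section LinearBasis.
Variables (k : fieldType) (V : lmodType k).

Definition linearly_independent (X : set V) : Prop :=
  forall (s : seq V) (c : V -> k), uniq s -> (forall x, x \in s -> X x) ->
    \sum_(x <- s) c x *: x = 0 -> forall x, x \in s -> c x = 0.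

Definition spanning (X : set V) : Prop :=
  forall v : V, exists (s : seq V) (c : V -> k),
    (forall x, x \in s -> X x) /\ v = \sum_(x <- s) c x *: x.

Definition linear_basis (X : set V) : Prop :=
  linearly_independent X /\ spanning X.

End LinearBasis.

Section Enveloping.
Variables (k : fieldType) (C : postCommAlgType k) (B : set C).

(* The element of C with coordinates c (supported on s) in B, written as a
   linear combination of the free generators. *)
Definition gen_comb (s : seq B) (c : B -> k) : freeRB k B :=
  \sum_(x <- s) c x *: freeRB_gen k x.

Definition val_comb (s : seq B) (c : B -> k) : C :=
  \sum_(x <- s) c x *: val x.

Inductive URB_rel : freeRB k B -> Prop :=
| URB_rel_succ (a b : B) (s : seq B) (c : B -> k) :
    psucc (val b) (val a) = val_comb s c ->
    URB_rel (rbmul (rbop (freeRB_gen k b)) (freeRB_gen k a) - gen_comb s c)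
| URB_rel_perp (a b : B) (s : seq B) (c : B -> k) :
    pperp (val a) (val b) = val_comb s c ->
    URB_rel (rbmul (freeRB_gen k a) (freeRB_gen k b) - gen_comb s c).

(* U_RB(C), presented from the set B, which is meant to be a basis of C. *)
Definition URB : commRBAlgType k := rb_quot URB_rel.

Definition URB_proj : freeRB k B -> URB := @rb_proj k (freeRB k B) URB_rel.

End Enveloping.

Section QuotientUniversal.
Variables (k : fieldType) (A A' : commRBAlgType k) (S : set A) (f : A -> A').
Hypotheses (fh : rb_hom f) (fS : forall x, S x -> f x = 0).

Lemma rb_ideal_ker x : rb_ideal S x -> f x = 0.
Proof.
case: fh => fl fm fr; elim=> {x} [x /fS//||a x y _ x0 _ y0|x y _ y0|x _ x0].
- by have := linear_sum fl [::] (fun=> 0) (fun _ : nat => 0); rewrite !big_nil.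
- by rewrite fl x0 y0 scaler0 addr0.
- by rewrite fm y0 rbmul0r.
- by rewrite fr x0 rbop0.
Qed.

Definition rb_quot_lift (x : rb_quot S) : A' := f (repr x).

Lemma rb_quot_liftE x : rb_quot_lift (rb_proj S x) = f x.
Proof.
case: (fh) => fl _ _; apply/eqP; rewrite -subr_eq0.
rewrite -scaleN1r addrC -fl scaleN1r addrC.
by rewrite rb_ideal_ker //; exact: rb_proj_repr.
Qed.

Lemma rb_quot_lift_hom : rb_hom rb_quot_lift.
Proof.
case: (fh) (rb_proj_hom S) => fl fm fr [pl pm pr]; split=> [a x y|x y|x].
- elim/rb_proj_surj: x => x; elim/rb_proj_surj: y => y.
  by rewrite -pl !rb_quot_liftE fl.
- elim/rb_proj_surj: x => x; elim/rb_proj_surj: y => y.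
  by rewrite -pm !rb_quot_liftE fm.
- by elim/rb_proj_surj: x => x; rewrite -pr !rb_quot_liftE fr.
Qed.

End QuotientUniversal.

Section URBUniversal.
Variables (k : fieldType) (C : postCommAlgType k) (B : set C).
Hypothesis hB : linear_basis B.

Let collect (W : lmodType k) (g : B -> W) (s r : seq B) (c : B -> k) :
    uniq r -> {subset s <= r} ->
  \sum_(x <- s) c x *: g x = \sum_(x <- r) (\sum_(y <- s | y == x) c y) *: g x.
Proof.
move=> ur sr; under [RHS]eq_bigr do rewrite scaler_suml big_mkcond /=.
rewrite exchange_big /= !big_seq; apply: eq_bigr => y ys.
rewrite (bigD1_seq y) ?sr //= eqxx big1 ?addr0 // => x.
by rewrite eq_sym => /negPf ->.
Qed.

Lemma val_comb_total v : exists (s : seq B) (c : B -> k), v = val_comb s c.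
Proof.
have [s [c [sB ->]]] := hB.2 v.
exists (pmap insub s), (c \o val).
elim: s sB => [|x s IHs] sB; first by rewrite /val_comb !big_nil.
have Bx : x \in B by apply/mem_set/sB; rewrite mem_head.
rewrite big_cons IHs => [|y ys]; last by apply: sB; rewrite inE ys orbT.
by rewrite /val_comb /= (insubT (fun x => x \in B) Bx) /= big_cons.
Qed.

Lemma gen_comb_wd s c t d :
  val_comb s c = val_comb t d :> C -> @gen_comb k C B s c = gen_comb t d.
Proof.
set r := undup (s ++ t); have ur : uniq r by exact: undup_uniq.
have sr : {subset s <= r} by move=> x xs; rewrite mem_undup mem_cat xs.
have tr : {subset t <= r} by move=> x xt; rewrite mem_undup mem_cat xt orbT.
rewrite /val_comb /gen_comb !(collect _ _ ur sr) !(collect _ _ ur tr).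
pose c' x := \sum_(y <- s | y == x) c y.
pose d' x := \sum_(y <- t | y == x) d y; move/eqP.
rewrite -subr_eq0 -sumrB => /eqP E.
suff cd x : x \in r -> c' x = d' x by rewrite !big_seq; apply: eq_bigr => x /cd; rewrite /c' /d' => ->.
move=> xr; apply/eqP; rewrite -subr_eq0; apply/eqP.
pose e (v : C) : k := if insub v is Some x then c' x - d' x else 0.
have eE (y : B) : e (val y) = c' y - d' y by rewrite /e valK.
rewrite -eE; apply: (hB.1 (map val r)); last by rewrite map_f.
- by rewrite map_inj_uniq //; exact: val_inj.
- by move=> _ /mapP[y _ ->]; apply: set_mem; exact: valP.
- rewrite big_map -[RHS]E; apply: eq_bigr => y _.
  by rewrite eE scalerBl.
Qed.

Lemma URB_incl_ex : {iota : C -> URB B |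
  forall s c, iota (val_comb s c) = URB_proj (gen_comb s c)}.
Proof.
apply: cid; have /choice[f fP] v : exists y : URB B, forall s c,
    v = val_comb s c -> y = URB_proj (gen_comb s c).
  have [s [c ->]] := val_comb_total v; exists (URB_proj (gen_comb s c)).
  by move=> t d /gen_comb_wd ->.
by exists f => s c; exact: fP.
Qed.

(* The canonical map C -> U_RB(C); it extends b |-> b linearly. *)
Definition URB_incl : C -> URB B := sval URB_incl_ex.

Lemma URB_inclE s c : URB_incl (val_comb s c) = URB_proj (gen_comb s c).
Proof. exact: (svalP URB_incl_ex). Qed.

Lemma URB_proj_hom : rb_hom (@URB_proj k C B).
Proof. exact: rb_proj_hom. Qed.

Lemma URB_incl_gen (b : B) : URB_incl (val b) = URB_proj (freeRB_gen k b).
Proof.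
have := URB_inclE [:: b] (fun=> 1); rewrite /val_comb /gen_comb.
by rewrite !big_seq1 !scale1r.
Qed.

Lemma URB_incl_linear : linear URB_incl.
Proof.
move=> a u v; have [s [c ->]] := val_comb_total u.
have [t [d ->]] := val_comb_total v.
set r := undup (s ++ t); have ur : uniq r by exact: undup_uniq.
have sr : {subset s <= r} by move=> x xs; rewrite mem_undup mem_cat xs.
have tr : {subset t <= r} by move=> x xt; rewrite mem_undup mem_cat xt orbT.
pose e x := a * (\sum_(y <- s | y == x) c y) + \sum_(y <- t | y == x) d y.
have E (W : lmodType k) (g : B -> W) : a *: (\sum_(x <- s) c x *: g x)
    + \sum_(x <- t) d x *: g x = \sum_(x <- r) e x *: g x.
  rewrite (collect _ _ ur sr) (collect _ _ ur tr) scaler_sumr -big_split.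
  by apply: eq_bigr => x _; rewrite /= scalerA -scalerDl.
rewrite !URB_inclE /val_comb E -/(val_comb r e) URB_inclE /gen_comb -E.
by have [-> _ _] := URB_proj_hom.
Qed.

Let basis_ext (W : lmodType k) (f g : C -> W) : linear f -> linear g ->
  (forall b : B, f (val b) = g (val b)) -> f =1 g.
Proof.
move=> fl gl fg v; have [s [c ->]] := val_comb_total v.
by rewrite /val_comb !linear_sum //; apply: eq_bigr => x _; rewrite fg.
Qed.

Let rel0 x : @URB_rel k C B x -> URB_proj x = 0.
Proof.
move=> Sx; have -> : (0 : URB B) = @URB_proj k C B 0 by [].
by apply/rb_projP; rewrite subr0; exact: RBIgen.
Qed.

Let projB x y : URB_proj (x - y) = URB_proj x - URB_proj y :> URB B.
Proof.
by rewrite -scaleN1r addrC; have [-> _ _] := URB_proj_hom;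
   rewrite scaleN1r addrC.
Qed.

Lemma URB_incl_hom : post_hom (URB_incl : C -> rbpost (URB B)).
Proof.
have il := URB_incl_linear; have [_ pm pr] := URB_proj_hom.
have rl (y : URB B) : linear (rbmul^~ y).
  by move=> a u v; rewrite rbmulDl rbmulZl.
split=> // x y.
- change (URB_incl (psucc x y) = rbmul (rbop (URB_incl x)) (URB_incl y)).
  move: y; apply: basis_ext.
  + exact: linear_comp (psucc_linearr x) il.
  + exact: linear_comp il (rbmul_linear _).
  move=> a; move: x.
  apply: (@basis_ext _ (fun x => URB_incl (psucc x (val a)))
    (fun x => rbmul (rbop (URB_incl x)) (URB_incl (val a)))).
  + exact: linear_comp (psucc_linearl (val a)) il.
  + exact: linear_comp (linear_comp il (@rbop_linear _ _)) (rl _).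
  move=> b; have [s [c E]] := val_comb_total (psucc (val b) (val a)).
  rewrite E URB_inclE !URB_incl_gen -pr -pm; apply/esym/eqP.
  by rewrite -subr_eq0 -projB; apply/eqP/rel0/URB_rel_succ.
- change (URB_incl (pperp x y) = rbmul (URB_incl x) (URB_incl y)).
  move: y; apply: basis_ext.
  + exact: linear_comp (pperp_linear x) il.
  + exact: linear_comp il (rbmul_linear _).
  move=> a; rewrite pperpC rbmulC; move: x; apply: basis_ext.
  + exact: linear_comp (pperp_linear (val a)) il.
  + exact: linear_comp il (rbmul_linear _).
  move=> b; have [s [c E]] := val_comb_total (pperp (val a) (val b)).
  rewrite E URB_inclE !URB_incl_gen -pm; apply/esym/eqP.
  by rewrite -subr_eq0 -projB; apply/eqP/rel0/URB_rel_perp.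
Qed.

Lemma URB_universal (A : commRBAlgType k) (f : C -> rbpost A) : post_hom f ->
  exists h : URB B -> A, [/\ rb_hom h, forall v, h (URB_incl v) = f v &
    forall h' : URB B -> A, rb_hom h' ->
      (forall v, h' (URB_incl v) = f v) -> h' =1 h].
Proof.
case=> fl fs fp; pose g (b : B) : A := f (val b).
have lh := freeRB_lift_hom g; have [ll lm lr] := lh.
have lB x y : freeRB_lift g (x - y) = freeRB_lift g x - freeRB_lift g y.
  by rewrite -scaleN1r addrC ll scaleN1r addrC.
have lcomb s c : freeRB_lift g (gen_comb s c) = f (val_comb s c).
  rewrite /gen_comb /val_comb !linear_sum //.
  by apply: eq_bigr => b _; rewrite freeRB_lift_gen.
have l0 x : URB_rel x -> freeRB_lift g x = 0.
  case=> a b s c E; rewrite lB lcomb -E lm ?lr !freeRB_lift_gen.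
    by rewrite fs subrr.
  by rewrite fp subrr.
have hh := rb_quot_lift_hom lh l0.
have agree (h1 h2 : C -> A) : linear h1 -> linear h2 ->
  (forall b : B, h1 (val b) = h2 (val b)) -> h1 =1 h2 by exact: basis_ext.
exists (rb_quot_lift (S := @URB_rel k C B) (freeRB_lift g)); split=> //.
- apply: agree => [||b]; [|exact: fl|].
    by apply: linear_comp URB_incl_linear _; case: hh.
  by rewrite URB_incl_gen rb_quot_liftE // freeRB_lift_gen.
- move=> h' h'h h'f; elim/rb_proj_surj=> x; rewrite rb_quot_liftE //.
  apply: (@freeRB_lift_unique _ _ _ g (h' \o @URB_proj k C B)) => [|b].
    have [pl pm pr] := URB_proj_hom; have [hl hm hr] := h'h.
    split=> [a u v|u v|u] /=; first by rewrite pl hl.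
      by rewrite pm hm.
    by rewrite pr hr.
  by rewrite /= -URB_incl_gen h'f.
Qed.

End URBUniversal.

Section StandardBase.
Variable I : choiceType.

Definition monomial : Type := {m : multiset I | m != mset0}.

Lemma monomial1_subproof (i : I) : [mset i]%mset != mset0.
Proof.
by apply/eqP => /(congr1 (fun m : multiset I => m i)); rewrite msetnxx mset0E.
Qed.

Definition monomial1 (i : I) : monomial := 
  exist (fun m : multiset I => m != mset0) _ (monomial1_subproof i).

(* SMon w, SOp u and SOpMul u w stand for w, R(u) and R(u)w. *)
Inductive stdword : Type :=
| SMon of monomial
| SOp of stdword
| SOpMul of stdword & monomial.

Inductive Eword : stdword -> Prop :=
| Eword1 i : Eword (SMon (monomial1 i))
| Eword2 u : Eword u -> Eword (SOp u)
| Eword3 x i : Eword x -> Eword (SOpMul (SOp x) (monomial1 i)).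

Variables (k : fieldType) (A : commRBAlgType k) (g : I -> A).

(* The default value 0 is never used: monomials are nonempty. *)
Definition monomial_val (m : monomial) : A :=
  if enum_mset (val m) is i :: s
  then foldl (fun x j => rbmul x (g j)) (g i) s else 0.

Lemma monomial_val1 i : monomial_val (monomial1 i) = g i.
Proof. by rewrite /monomial_val /= enum_msetn. Qed.

Fixpoint stdword_val (u : stdword) : A :=
  match u with
  | SMon w => monomial_val w
  | SOp u => rbop (stdword_val u)
  | SOpMul u w => rbmul (rbop (stdword_val u)) (monomial_val w)
  end.

End StandardBase.

(* The image of a word over B under the canonical map from the free algebra. *)
Definition URB_word (k : fieldType) (C : postCommAlgType k) (B : set C)
    (u : stdword B) : URB B :=
  URB_proj (stdword_val (@freeRB_gen k B) u).

(* Main.v *)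
(* Write x * y = x > y + y > x + x _|_ y; this product is commutative and
   associative.  Let D be C with this product, let D^# be its unital hull
   (basis option B), and let D^# act on (C, _|_) by >; this gives a commutative
   algebra D^# + C (basis option B + B).  Let H be the quasi-shuffle algebra over
   D^# (basis: words in option B) and F = H (x) D^#, which is the free commutative
   RB-algebra on D^#.

   Independence.  The algebra A = H (x) (D^# + C) contains F.  There is an algebra
   morphism S : F -> A (shift) with S(R f) = R f + f and S(c) = c + c', where c'
   is the copy of c in the summand C.  The map theta = S - incl has an inverse
   sigma on the augmentation ideal of F, and multiplicativity of S says exactly
   that incl o sigma is an RB-operator of weight 1 on A, for which c |-> c' is a
   morphism of postcommutative algebras.  The E-words b, R(u) and R^2(v)a take
   there the values b', sigma(u) and R(sigma(v)) (x) a', so each of them has a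
   dual functional.

   Spanning.  In U_RB(C), with x * y = R(x)y + xR(y) + xy, the span of the words
   obtained from C by R and x |-> R(x) * c is closed under *; it coincides with
   the span of the E-words, which is therefore closed under the product. *)

Require Import Defs.
From HB Require Import structures.
From mathcomp Require Import all_boot all_order all_algebra.
From mathcomp Require Import boolp classical_sets functions.
From mathcomp.multinomials Require Import freeg.

Set Implicit Arguments.
Unset Strict Implicit.
Unset Printing Implicit Defensive.

Import GRing.Theory.
Local Open Scope ring_scope.
Local Open Scope classical_set_scope.

(** * Free modules and bilinear extension *)

Section LinearMaps.
Variables (k : fieldType) (U V W : lmodType k).

Lemma linear_fun0 (f : U -> V) : linear f -> f 0 = 0.
Proof.
by move=> fl; have := fl (-1) 0 0; rewrite scaler0 addr0 scaleN1r addNr.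
Qed.

Lemma linear_funD (f : U -> V) : linear f -> {morph f : x y / x + y}.
Proof. by move=> fl x y; have := fl 1 x y; rewrite !scale1r. Qed.

Lemma linear_funZ (f : U -> V) a : linear f -> {morph f : x / a *: x}.
Proof. by move=> fl x; have := fl a x 0; rewrite linear_fun0 // !addr0. Qed.

Lemma linear_funN (f : U -> V) : linear f -> {morph f : x / - x}.
Proof. by move=> fl x; rewrite -scaleN1r linear_funZ // scaleN1r. Qed.

Lemma linear_funB (f : U -> V) : linear f -> {morph f : x y / x - y}.
Proof. by move=> fl x y; rewrite linear_funD // linear_funN. Qed.

Lemma linear_fid : linear (fun x : U => x).
Proof. by []. Qed.

Lemma linear_fadd (f g : U -> V) :
  linear f -> linear g -> linear (fun x => f x + g x).
Proof. by move=> fl gl a x y; rewrite fl gl scalerDr addrACA. Qed.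

Lemma linear_fopp (f : U -> V) : linear f -> linear (fun x => - f x).
Proof. by move=> fl a x y; rewrite fl opprD scalerN. Qed.

Lemma linear_fzero : linear (fun _ : U => 0 : V).
Proof. by move=> a x y; rewrite scaler0 addr0. Qed.

Lemma linear_fscale (f : U -> V) c : linear f -> linear (fun x => c *: f x).
Proof. by move=> fl a x y; rewrite fl scalerDr !scalerA mulrC. Qed.

Lemma linear_fcomp (g : V -> W) (f : U -> V) :
  linear g -> linear f -> linear (fun x => g (f x)).
Proof. by move=> gl fl a x y; rewrite fl gl. Qed.

End LinearMaps.

Local Notation L k X := {freeg X / k}.

Section FreeModule.
Variables (k : fieldType) (X : choiceType).

Definition fgen (x : X) : L k X := << x >>.
Definition flift (V : lmodType k) (f : X -> V) : L k X -> V := fglift f.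

Lemma fliftE (V : lmodType k) (f : X -> V) x : flift f (fgen x) = f x.
Proof. by rewrite /flift /fgen liftU scale1r. Qed.

Lemma freeg_expand (u : L k X) : u = \sum_(x <- dom u) coeff x u *: fgen x.
Proof.
rewrite -[LHS]freeg_sumE; apply: eq_bigr => x _; apply/eqP/freeg_eqP => y.
by rewrite coeffZ !coeffU mul1r.
Qed.

Lemma flift_linear (V : lmodType k) (f : X -> V) : linear (flift f).
Proof.
pose g (u : L k X) := \sum_(x <- dom u) coeff x u *: f x.
have D : {morph flift f : u v / u + v}.
  move=> u v; have fN := lift_is_additive f; rewrite /flift.
  have f0 : fglift f 0 = 0 by rewrite -[in LHS](subrr 0) fN subrr.
  have fNv : fglift f (- v) = - fglift f v by rewrite -[in LHS]sub0r fN f0 sub0r.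
  by rewrite -[in LHS](opprK v) fN fNv opprK.
have U1 a x : flift f << a *g x >> = a *: f x by rewrite /flift liftU.
have S (r : seq X) (c : X -> k) :
    flift f (\sum_(x <- r) << c x *g x >>) = \sum_(x <- r) c x *: f x.
  elim: r => [|x r IH]; last by rewrite !big_cons D U1 IH.
  by rewrite !big_nil; apply: (addrI (flift f 0)); rewrite -D !addr0.
have Z a u : flift f (a *: u) = a *: flift f u.
  have Eu : flift f u = \sum_(x <- dom u) coeff x u *: f x by rewrite -S freeg_sumE.
  have -> : a *: u = \sum_(x <- dom u) << a * coeff x u *g x >> by [].
  by rewrite S Eu scaler_sumr; apply: eq_bigr => x _; rewrite scalerA.
by move=> a u v; rewrite D Z.
Qed.

Lemma freeg_ext (V : lmodType k) (f g : L k X -> V) : linear f -> linear g ->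
  (forall x, f (fgen x) = g (fgen x)) -> forall u, f u = g u.
Proof.
move=> fl gl fg u; rewrite (freeg_expand u) !Defs.linear_sum //.
by apply: eq_bigr => x _; rewrite fg.
Qed.

End FreeModule.

Section Bilinear.
Variables (k : fieldType) (X Y : choiceType) (V : lmodType k).

(** The bilinear extension of [f] from pairs of basis elements. Every product of the model is [bl m]
    for some structure constants [m], so its identities are checked on generators. *)
Definition bl (f : X -> Y -> V) (u : L k X) (v : L k Y) : V :=
  flift (fun x => flift (f x) v) u.

Lemma bl_linearl f v : linear (fun u => bl f u v).
Proof. exact: flift_linear. Qed.

Lemma bl_linearr f u : linear (bl f u).
Proof.
move=> a v w; move: u; apply: freeg_ext.
- exact: flift_linear.
- by apply: linear_fadd; [apply: linear_fscale|]; exact: bl_linearl.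
- by move=> x; rewrite /bl !fliftE flift_linear.
Qed.

Lemma blE f x y : bl f (fgen k x) (fgen k y) = f x y.
Proof. by rewrite /bl !fliftE. Qed.

End Bilinear.

(** Proves linearity of maps built from lifts, bilinear extensions, sums and linear hypotheses, the
    side conditions of [freeg_ext]. *)
Local Ltac lin := first
  [ exact: linear_fid | exact: linear_fzero | assumption
  | exact: flift_linear | exact: bl_linearr | exact: bl_linearl
  | match goal with
    | H : linear ?h |- context [fun x => ?h (@?f x)] =>
        apply: (linear_fcomp H (f := f)); lin
    | |- context [fun x => @GRing.add _ (@?f x) (@?g x)] =>
        apply: (@linear_fadd _ _ _ f g); lin
    | |- context [fun x => @flift _ _ _ ?F (@?f x)] =>
        apply: (linear_fcomp (flift_linear F) (f := f)); lin
    | |- context [fun x => @bl _ _ _ _ ?F ?c (@?f x)] =>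
        apply: (linear_fcomp (bl_linearr F c) (f := f)); lin
    | |- context [fun x => @bl _ _ _ _ ?F (@?f x) ?c] =>
        apply: (linear_fcomp (bl_linearl F c) (f := f)); lin
    end ].

Section Push.
Variable k : fieldType.

Definition push (I J : choiceType) (f : I -> J) : L k I -> L k J :=
  flift (fun i => fgen k (f i)).

Lemma pushE (I J : choiceType) (f : I -> J) i : push f (fgen k i) = fgen k (f i).
Proof. exact: fliftE. Qed.

Lemma push_linear (I J : choiceType) (f : I -> J) : linear (push f).
Proof. exact: flift_linear. Qed.

Lemma bl_push (I J K I' J' K' : choiceType) (m : I -> J -> L k K)
    (m' : I' -> J' -> L k K') (f : I -> I') (g : J -> J') (h : K -> K') :
  (forall i j, m' (f i) (g j) = push h (m i j)) ->
  forall u v, bl m' (push f u) (push g v) = push h (bl m u v).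
Proof.
move=> E u v; rewrite /push; move: u; apply: freeg_ext; [lin..|] => i.
move: v; apply: freeg_ext; [lin..|] => j.
by rewrite !fliftE !blE E.
Qed.

End Push.

(** * Tensor products and quasi-shuffles *)

Section StructureConstants.
Variables (k : fieldType) (X : choiceType) (m : X -> X -> L k X).

Lemma bl_comm : (forall x y, m x y = m y x) -> commutative (bl m).
Proof.
move=> mC u v; move: u; apply: freeg_ext; [lin..|] => x.
by move: v; apply: freeg_ext; [lin..|] => y; rewrite !blE.
Qed.

Lemma bl_assoc :
  (forall x y z, bl m (fgen k x) (m y z) = bl m (m x y) (fgen k z)) ->
  associative (bl m).
Proof.
move=> mA u v w; move: u; apply: freeg_ext; [lin..|] => x.
move: v; apply: freeg_ext; [lin..|] => y.
by move: w; apply: freeg_ext; [lin..|] => z; rewrite !blE.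
Qed.

End StructureConstants.

Section Tensor.
Variables (k : fieldType) (X Z : choiceType).

Definition tens : L k X -> L k Z -> L k (X * Z)%type :=
  bl (fun x z => fgen k (x, z)).

Lemma tens_linearl a : linear (fun u => tens u a).
Proof. exact: bl_linearl. Qed.

Lemma tens_linearr u : linear (tens u).
Proof. exact: bl_linearr. Qed.

Lemma tens_ext (V : lmodType k) (f g : L k (X * Z)%type -> V) :
    linear f -> linear g ->
  (forall x z, f (tens (fgen k x) (fgen k z)) = g (tens (fgen k x) (fgen k z))) ->
  forall u, f u = g u.
Proof.
by move=> fl gl fg; apply: freeg_ext => // -[x z]; have := fg x z; rewrite /tens blE.
Qed.

Variables (mX : X -> X -> L k X) (mZ : Z -> Z -> L k Z).

Definition tens_mul (p q : X * Z) : L k (X * Z)%type :=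
  tens (mX p.1 q.1) (mZ p.2 q.2).

Lemma tens_mulE u v a b :
  bl tens_mul (tens u a) (tens v b) = tens (bl mX u v) (bl mZ a b).
Proof.
rewrite /tens; move: u; apply: freeg_ext; [lin..|] => x.
move: v; apply: freeg_ext; [lin..|] => y.
move: a; apply: freeg_ext; [lin..|] => z.
by move: b; apply: freeg_ext; [lin..|] => t; rewrite !blE.
Qed.

Lemma tens_mulC : commutative (bl mX) -> commutative (bl mZ) ->
  commutative (bl tens_mul).
Proof.
move=> XC ZC; apply: bl_comm => -[x z] [y t]; rewrite /tens_mul /=.
by rewrite -!(blE mX) -!(blE mZ) XC ZC.
Qed.

Lemma tens_mulA : associative (bl mX) -> associative (bl mZ) ->
  associative (bl tens_mul).
Proof.
move=> XA ZA; apply: bl_assoc => -[x z] [y t] [w s].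
have E p : fgen k p = tens (fgen k p.1) (fgen k p.2) by rewrite /tens blE; case: p.
by rewrite /tens_mul !E /= !tens_mulE -!(blE mX) -!(blE mZ) XA ZA.
Qed.

End Tensor.

(** * The quasi-shuffle algebra over a commutative algebra *)

Section QuasiShuffle.
Variables (k : fieldType) (Y : choiceType) (m : Y -> Y -> L k Y).
Hypotheses (mC : commutative (bl m)) (mA : associative (bl m)).
Let H := L k (seq Y).

Definition lcons : L k Y -> H -> H := bl (fun y w => fgen k (y :: w)).

(** The inner fixpoint lets the recursion shorten either word. The last summand, which contracts the
    two first letters by [m], is what the ordinary shuffle product does not have. *)
Fixpoint qshuffle (u v : seq Y) : H :=
  match u with
  | [::] => fgen k v
  | y :: u' =>
    (fix qshr (v : seq Y) : H :=
       match v with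
       | [::] => fgen k u
       | z :: v' => lcons (fgen k y) (qshuffle u' v) + lcons (fgen k z) (qshr v')
           + lcons (m y z) (qshuffle u' v')
       end) v
  end.

Local Notation "f · g" := (bl qshuffle f g) (at level 40).
Let one : H := fgen k [::].

Lemma lconsE y w : lcons (fgen k y) (fgen k w) = fgen k (y :: w).
Proof. exact: blE. Qed.

Lemma qsh1f f : one · f = f.
Proof. by move: f; apply: freeg_ext; [lin..|] => w; rewrite blE. Qed.

Lemma qshf1 f : f · one = f.
Proof. by move: f; apply: freeg_ext; [lin..|] => -[|y w]; rewrite blE. Qed.

Lemma qsh_cons a f b g : lcons a f · lcons b g =
  lcons a (f · lcons b g) + lcons b (lcons a f · g) + lcons (bl m a b) (f · g).
Proof.
rewrite /lcons; move: a; apply: freeg_ext; [lin..|] => y.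
move: f; apply: freeg_ext; [lin..|] => u.
move: b; apply: freeg_ext; [lin..|] => z.
by move: g; apply: freeg_ext; [lin..|] => v; rewrite !blE.
Qed.

Lemma qshC : commutative (bl qshuffle).
Proof.
apply: bl_comm; elim=> [|y u IHu]; first by case.
elim=> [//|z v IHv]; have := IHu (z :: v); have := IHu v; move: IHv.
rewrite -!(blE qshuffle) -!lconsE !qsh_cons => -> -> ->.
by rewrite mC; congr (_ + _); rewrite addrC.
Qed.

Lemma qshA : associative (bl qshuffle).
Proof.
apply: bl_assoc => u v w; rewrite -!(blE qshuffle).
have [n] := ubnP (size u + size v + size w); elim: n u v w => // n IHn.
move=> [|x u] [|y v] [|z w]; rewrite ?qsh1f ?qshf1 //= ltnS => le_n.
have lD a : {morph lcons a : f g / f + g}.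
  by apply: linear_funD; apply: bl_linearr.
have rD f : {morph bl qshuffle f : g h / g + h}.
  by apply: linear_funD; apply: bl_linearr.
have llD f : {morph (bl qshuffle)^~ f : g h / g + h}.
  by apply: linear_funD; apply: bl_linearl.
(* Induction on the total length: the seven instances shorten each nonempty subset of the three
   words. *)
have I1 := IHn u (y :: v) (z :: w); have I2 := IHn (x :: u) v (z :: w).
have I3 := IHn (x :: u) (y :: v) w; have I4 := IHn u v (z :: w).
have I5 := IHn u (y :: v) w; have I6 := IHn (x :: u) v w; have I7 := IHn u v w.
move: I1 I2 I3 I4 I5 I6 I7 le_n; rewrite /= !(addSn, addnS).
move=> I1 I2 I3 I4 I5 I6 I7 lt2; have lt1 := ltnW lt2; have lt0 := ltnW lt1.
move: (I1 lt2) (I2 lt2) (I3 lt2) (I4 lt1) (I5 lt1) (I6 lt1) (I7 lt0).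
move=> {I1 I2 I3 I4 I5 I6 I7 lt0 lt1 lt2 IHn}; rewrite -!lconsE.
move: (fgen k x) (fgen k y) (fgen k z) => {}x {}y {}z.
move: (fgen k u) (fgen k v) (fgen k w) => {}u {}v {}w.
move=> I1 I2 I3 I4 I5 I6 I7.
(* Expansion splits the words beginning with x into three terms on the left only, and those
   beginning with z into three on the right only. [E1] and [E2] split the unsplit term on the other
   side, which gives eleven matching summands. *)
have E1 : lcons x ((u · lcons y v) · lcons z w) =
    lcons x (u · lcons y (v · lcons z w)) + lcons x (u · lcons z (lcons y v · w))
    + lcons x (u · lcons (bl m y z) (v · w)).
  by rewrite -I1 qsh_cons !(rD, lD).
have E2 : lcons z (lcons x u · (lcons y v · w)) =
    lcons z (lcons x (u · lcons y v) · w) + lcons z (lcons y (lcons x u · v) · w)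
    + lcons z (lcons (bl m x y) (u · v) · w).
  by rewrite I3 qsh_cons !(llD, lD).
rewrite (qsh_cons y v z w) (qsh_cons x u y v) !(rD, llD) !qsh_cons.
rewrite E1 E2 I2 I4 I5 I6 I7 mA.
rewrite !addrA [LHS](ACl (1*4*9*5*8*2*6*10*3*7*11)).
by [].
Qed.
End QuasiShuffle.

(** * The algebra D^# + C *)

Section PostCommTheory.
Variables (k : fieldType) (C : postCommAlgType k).
Implicit Types x y z : C.

Definition pstar x y := psucc x y + psucc y x + pperp x y.

Lemma psuccDr x y z : psucc x (y + z) = psucc x y + psucc x z.
Proof. exact: (linear_funD (psucc_linearr x)). Qed.

Lemma pperpDr x y z : pperp x (y + z) = pperp x y + pperp x z.
Proof. exact: (linear_funD (pperp_linear x)). Qed.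

Lemma pperpDl x y z : pperp (x + y) z = pperp x z + pperp y z.
Proof. by rewrite !(pperpC _ z) pperpDr. Qed.

Lemma pperp_linearl y : linear (fun x => pperp x y).
Proof. by move=> a u v; rewrite !(pperpC _ y) pperp_linear. Qed.

Lemma pstar_linearr x : linear (pstar x).
Proof.
apply: linear_fadd; last exact: pperp_linear.
by apply: linear_fadd; [apply: psucc_linearr | apply: psucc_linearl].
Qed.

Lemma pstarC : commutative pstar.
Proof. by move=> x y; rewrite /pstar (addrC (psucc x y)) pperpC. Qed.

Lemma pstar_linearl y : linear (fun x => pstar x y).
Proof. by move=> a u v; rewrite !(pstarC _ y) pstar_linearr. Qed.

(** By [psuccA], [psucc] is an action of the commutative product [pstar], so the operators [psucc x]
    commute. *)
Lemma psuccCA x y z : psucc x (psucc y z) = psucc y (psucc x z).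
Proof. by rewrite -!psuccA -!/(pstar _ _) pstarC. Qed.

Lemma pstarA : associative pstar.
Proof.
move=> x y z; rewrite {1 3}/pstar psuccA /pstar psuccA !(psuccDr, pperpDr, pperpDl).
rewrite (psuccCA x z y) (psuccCA y z x) !psucc_perp -!pperp_succ pperpA.
by rewrite !addrA [LHS](ACl (1*2*4*6*3*5*7)).
Qed.

End PostCommTheory.

(** * Coordinates with respect to a basis of C *)

Section Coordinates.
Variables (k : fieldType) (C : postCommAlgType k) (B : set C).
Hypothesis hB : linear_basis B.

Definition evB : L k B -> C := flift (fun b => val b).

Lemma evB_inj u : evB u = 0 -> u = 0.
Proof.
rewrite [in evB u](freeg_expand u) /evB (Defs.linear_sum (flift_linear _)) => E.
rewrite (freeg_expand u) big_seq big1 // => x xu.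
(* Independence is stated with coefficients indexed by all of C, so the coefficients are extended by
   0 outside B. *)
pose c (v : C) : k := if insub v is Some y then coeff y u else 0.
have cE (y : B) : c (val y) = coeff y u by rewrite /c valK.
rewrite -cE (hB.1 (map val (dom u)) c) ?scale0r ?map_f //.
- by rewrite map_inj_uniq ?uniq_dom //; exact: val_inj.
- by move=> _ /mapP[y _ ->]; apply: set_mem; exact: valP.
- by rewrite big_map -[RHS]E; apply: eq_bigr => y _; rewrite cE fliftE.
Qed.

Lemma coordB_ex : {c : C -> L k B | forall v, evB (c v) = v}.
Proof.
have /choice[c cP] v : exists u, evB u = v; last by exists c.
have [s [c ->]] := val_comb_total hB v; exists (\sum_(x <- s) c x *: fgen k x).
rewrite /evB (Defs.linear_sum (flift_linear _)).
by apply: eq_bigr => x _; rewrite fliftE.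
Qed.

Definition coordB : C -> L k B := sval coordB_ex.

Lemma coordBK v : evB (coordB v) = v.
Proof. exact: (svalP coordB_ex). Qed.

Lemma evBK u : coordB (evB u) = u.
Proof.
apply/eqP; rewrite -subr_eq0; apply/eqP/evB_inj.
by rewrite /evB (linear_funB (flift_linear _)) -/evB coordBK subrr.
Qed.

Lemma coordB_linear : linear coordB.
Proof.
by move=> a u v; rewrite -[RHS]evBK /evB flift_linear -/evB !coordBK.
Qed.

Lemma coordB_val (b : B) : coordB (val b) = fgen k b.
Proof. by rewrite -[RHS]evBK /evB fliftE. Qed.

Definition struct_const (p : C -> C -> C) (a b : B) : L k B :=
  coordB (p (val a) (val b)).

Lemma struct_constE (p : C -> C -> C) :
  (forall x, linear (p x)) -> (forall y, linear (fun x => p x y)) ->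
  forall u v, bl (struct_const p) u v = coordB (p (evB u) (evB v)).
Proof.
move=> pr pl u v; move: u; apply: freeg_ext; first lin.
  apply: (linear_fcomp coordB_linear); apply: (linear_fcomp (pl _)).
  exact: flift_linear.
move=> a; move: v; apply: freeg_ext; first lin.
  apply: (linear_fcomp coordB_linear); apply: (linear_fcomp (pr _)).
  exact: flift_linear.
by move=> b; rewrite blE /evB !fliftE.
Qed.

Lemma coordB_prod (p : C -> C -> C) :
  (forall x, linear (p x)) -> (forall y, linear (fun x => p x y)) ->
  forall c d, coordB (p c d) = bl (struct_const p) (coordB c) (coordB d).
Proof. by move=> pr pl c d; rewrite struct_constE // !coordBK. Qed.

End Coordinates.

(** * Structure constants of D^# and D^# + C *)

Section Model.
Variables (k : fieldType) (C : postCommAlgType k) (B : set C).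
Hypothesis hB : linear_basis B.

Local Notation Y := (option B).
Local Notation Z := (option B + B)%type.
Local Notation coord := (coordB hB).

Local Notation sc := (struct_const hB).

(** [None] is the adjoined unit and [Some] embeds the basis of D. *)
Definition mulY (y z : Y) : L k Y :=
  match y, z with
  | None, _ => fgen k z
  | _, None => fgen k y
  | Some a, Some b => push some (sc (@pstar k C) a b)
  end.

Definition actY (y : Y) (b : B) : L k B :=
  if y is Some a then sc (@psucc k C) a b else fgen k b.

Definition mulZ (z t : Z) : L k Z :=
  match z, t with
  | inl y, inl y' => push inl (mulY y y')
  | inl y, inr b => push inr (actY y b)
  | inr b, inl y => push inr (actY y b)
  | inr a, inr b => push inr (sc (@pperp k C) a b)
  end.

(** The copies of c in D^#, in the part D of D^# + C, and in the summand C. In these terms products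
    of basis elements become operations of C, to which the axioms apply. *)
Definition eY (c : C) : L k Y := push some (coord c).
Definition eD (c : C) : L k Z := push inl (eY c).
Definition eC (c : C) : L k Z := push inr (coord c).
Local Notation oneY := (fgen k (None : Y)).
Local Notation oneZ := (fgen k (inl None : Z)).

Lemma fgenY (a : B) : fgen k (Some a) = eY (val a).
Proof. by rewrite /eY coordB_val pushE. Qed.

Lemma fgenD (a : B) : fgen k (inl (Some a)) = eD (val a).
Proof. by rewrite /eD -fgenY pushE. Qed.

Lemma fgenC (a : B) : fgen k (inr a) = eC (val a).
Proof. by rewrite /eC coordB_val pushE. Qed.

Lemma mulY1f u : bl mulY oneY u = u.
Proof. by move: u; apply: freeg_ext; [lin..|] => -[a|]; rewrite blE. Qed.

Lemma mulYf1 u : bl mulY u oneY = u.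
Proof. by move: u; apply: freeg_ext; [lin..|] => -[a|]; rewrite blE. Qed.

Lemma mulY_e c d : bl mulY (eY c) (eY d) = eY (pstar c d).
Proof.
have /(_ c d) := coordB_prod hB (@pstar_linearr k C) (@pstar_linearl k C).
rewrite /eY => ->.
by apply: bl_push.
Qed.

Lemma mulYC : commutative (bl mulY).
Proof.
by apply: bl_comm => -[a|] [b|] //=; congr push; rewrite /struct_const pstarC.
Qed.

Lemma mulYA : associative (bl mulY).
Proof.
apply: bl_assoc => -[a|] [b|] [c|]; rewrite -!(blE mulY) ?mulY1f ?mulYf1 //.
by rewrite !fgenY !mulY_e pstarA.
Qed.

Lemma mulZ_D u v : bl mulZ (push inl u) (push inl v) = push inl (bl mulY u v).
Proof. by apply: bl_push. Qed.

Lemma mulZ_act u v : bl mulZ (push inl u) (push inr v) = push inr (bl actY u v).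
Proof. by apply: bl_push. Qed.

Lemma mulZ_DC c d : bl mulZ (eD c) (eC d) = eC (psucc c d).
Proof.
rewrite /eC.
have /(_ c d) := coordB_prod hB (@psucc_linearr k C) (@psucc_linearl k C).
rewrite /eY => ->.
rewrite mulZ_act; congr push; rewrite /eY; move: (coord c) => {}c; rewrite /push.
move: c; apply: freeg_ext; [lin..|] => a.
by move: (coord d); apply: freeg_ext; [lin..|] => b; rewrite fliftE !blE.
Qed.

Lemma mulZ_CC c d : bl mulZ (eC c) (eC d) = eC (pperp c d).
Proof.
rewrite /eC.
have /(_ c d) := coordB_prod hB (@pperp_linear k C) (@pperp_linearl k C).
rewrite /eY => ->.
by apply: bl_push.
Qed.

Lemma mulZ_DD c d : bl mulZ (eD c) (eD d) = eD (pstar c d).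
Proof. by rewrite mulZ_D mulY_e. Qed.

Lemma mulZ1f u : bl mulZ oneZ u = u.
Proof. by move: u; apply: freeg_ext; [lin..|] => -[[y|]|b]; rewrite blE /= ?pushE. Qed.

Lemma mulZC : commutative (bl mulZ).
Proof.
apply: bl_comm => -[y|a] [z|b] //=; first by rewrite -!(blE mulY) mulYC.
by congr push; rewrite /struct_const pperpC.
Qed.

Lemma mulZf1 u : bl mulZ u oneZ = u.
Proof. by rewrite mulZC mulZ1f. Qed.

Lemma mulZ_CD c d : bl mulZ (eC d) (eD c) = eC (psucc c d).
Proof. by rewrite mulZC mulZ_DC. Qed.

Lemma mulZA : associative (bl mulZ).
Proof.
apply: bl_assoc => -[[a|]|a] [[b|]|b] [[c|]|c];
  rewrite -!(blE mulZ) ?mulZ1f ?mulZf1 //;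
  rewrite ?fgenD ?fgenC !(mulZ_DD, mulZ_DC, mulZ_CD, mulZ_CC) ?pstarA //;
  congr eC.
(* Triples containing the unit and the triple inside D are settled; the seven left have at least one
   factor in C. *)
- by rewrite -psuccA.
- by rewrite psuccCA.
- by rewrite psucc_perp.
- by rewrite /pstar psuccA psuccCA.
- by rewrite pperp_succ.
- by rewrite psucc_perp pperp_succ.
- by rewrite pperpA.
Qed.
End Model.

(** * The Rota-Baxter model *)

Section RBModel.
Variables (k : fieldType) (C : postCommAlgType k) (B : set C).
Hypothesis hB : linear_basis B.

Local Notation Y := (option B).
Local Notation Z := (option B + B)%type.
Local Notation X := (seq Y).
Local Notation F := (L k (X * Y)%type).
Local Notation A := (L k (X * Z)%type).
Local Notation mY := (mulY hB).
Local Notation mZ := (mulZ hB).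
Local Notation qsh := (qshuffle mY).
Local Notation oneX := (fgen k ([::] : X)).
Local Notation oneY := (fgen k (None : Y)).
Local Notation oneZ := (fgen k (inl None : Z)).

Definition mulF : X * Y -> X * Y -> F := tens_mul qsh mY.
Definition mulA : X * Z -> X * Z -> A := tens_mul qsh mZ.

Lemma mulFE u v a b :
  bl mulF (tens u a) (tens v b) = tens (bl qsh u v) (bl mY a b).
Proof. exact: tens_mulE. Qed.

Lemma mulAE u v a b :
  bl mulA (tens u a) (tens v b) = tens (bl qsh u v) (bl mZ a b).
Proof. exact: tens_mulE. Qed.

Lemma mulA_comm : commutative (bl mulA).
Proof. exact: tens_mulC (qshC (mulYC hB)) (mulZC hB). Qed.

Lemma mulA_assoc : associative (bl mulA).
Proof. exact: tens_mulA (qshA (mulYA hB)) (mulZA hB). Qed.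

Lemma mulA1f f : bl mulA (tens oneX oneZ) f = f.
Proof.
move: f; apply: tens_ext; [lin..|] => x z.
by rewrite mulAE qsh1f mulZ1f.
Qed.

(** * The inclusion of F in A and the shift morphism S *)

Definition incl : F -> A := push (fun p => (p.1, inl p.2)).

Lemma inclE u a : incl (tens u a) = tens u (push inl a).
Proof.
rewrite /incl /tens /push; move: u; apply: freeg_ext; [lin..|] => x.
by move: a; apply: freeg_ext; [lin..|] => y; rewrite !(blE, fliftE).
Qed.

Lemma inclM f g : incl (bl mulF f g) = bl mulA (incl f) (incl g).
Proof.
have il : linear incl by exact: flift_linear.
move: f; apply: tens_ext.
- lin.
- by rewrite /incl /push; lin.
move=> x y; move: g; apply: tens_ext.
- lin.
- by rewrite /incl /push; lin.
by move=> x' y'; rewrite mulFE !inclE mulAE mulZ_D.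
Qed.

(* [shiftX (y :: w)] reads S (R u) = R u + u for u = w (x) y. *)
Definition shiftX (w : X) : A :=
  if w is y :: w' then tens (fgen k w) oneZ + tens (fgen k w') (fgen k (inl y))
  else tens oneX oneZ.

Definition shiftY (y : Y) : A :=
  tens oneX (if y is Some b then fgen k (inl (Some b)) + fgen k (inr b) else oneZ).

Definition shift : F -> A :=
  flift (fun p => bl mulA (shiftX p.1) (shiftY p.2)).

Lemma shift_linear : linear shift.
Proof. exact: flift_linear. Qed.

Lemma shiftX_lcons a f : flift shiftX (lcons a f) =
  tens (lcons a f) oneZ + tens f (push inl a).
Proof.
rewrite /lcons /tens /push; move: a; apply: freeg_ext; [lin..|] => y.
by move: f; apply: freeg_ext; [lin..|] => w; rewrite !(blE, fliftE) /= /tens !blE.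
Qed.

(** With S(R f) = R f + f, the product S(R f) S(R g) equals R h + h = S(R h) for h = (R f) g + f (R
    g) + f g, and R h = (R f)(R g). *)
Lemma shiftXM f g :
  flift shiftX (bl qsh f g) = bl mulA (flift shiftX f) (flift shiftX g).
Proof.
move: f; apply: freeg_ext; [lin..|] => -[|y u].
  by rewrite qsh1f fliftE mulA1f.
move: g; apply: freeg_ext; [lin..|] => -[|z v].
  by rewrite qshf1 fliftE [X in bl _ _ X]fliftE mulA_comm mulA1f.
have SD := linear_funD (flift_linear shiftX).
rewrite -!lconsE qsh_cons !SD !shiftX_lcons !pushE.
rewrite !(linear_funD (bl_linearr _ _)) !(linear_funD (bl_linearl _ _)).
rewrite !mulAE qsh_cons mulZ1f !mulZf1 mulZ1f.
rewrite -(pushE k inl y) -(pushE k inl z) mulZ_D !(linear_funD (tens_linearl _)).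
by rewrite !addrA [LHS](ACl (1*3*5*2*4*6)).
Qed.

Lemma shiftY_e c : flift shiftY (eY hB c) = tens oneX (eD hB c + eC hB c).
Proof.
rewrite /eD /eY /eC /push; move: (coordB hB c); rewrite /tens.
apply: freeg_ext; [lin..|] => b.
by rewrite !fliftE.
Qed.

(** In (c + c')(d + d') the mixed products and c' d' add up to the copy of [pstar c d] in C. *)
Lemma shiftYM a b :
  flift shiftY (bl mY a b) = bl mulA (flift shiftY a) (flift shiftY b).
Proof.
move: a; apply: freeg_ext; [lin..|] => -[c|]; last first.
  by rewrite mulY1f [flift _ (fgen _ _)]fliftE mulA1f.
move: b; apply: freeg_ext; [lin..|] => -[d|]; last first.
  by rewrite mulYf1 mulA_comm [flift _ oneY]fliftE mulA1f.
rewrite !fgenY mulY_e !shiftY_e mulAE qsh1f.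
rewrite !(linear_funD (bl_linearr _ _)) !(linear_funD (bl_linearl _ _)).
rewrite mulZ_DD mulZ_DC mulZ_CD mulZ_CC /pstar.
have eD' := linear_funD (linear_fcomp (push_linear inr) (coordB_linear hB)).
by rewrite /eC !eD' !addrA [X in tens _ X](ACl (1*3*2*4)).
Qed.

Lemma shiftE u a :
  shift (tens u a) = bl mulA (flift shiftX u) (flift shiftY a).
Proof.
rewrite /shift /tens; move: u; apply: freeg_ext; [lin..|] => x.
by move: a; apply: freeg_ext; [lin..|] => y; rewrite !(blE, fliftE).
Qed.

Lemma shiftM f g : shift (bl mulF f g) = bl mulA (shift f) (shift g).
Proof.
have il := shift_linear.
move: f; apply: tens_ext.
- lin.
- by rewrite /shift; lin.
move=> x y; move: g; apply: tens_ext.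
- lin.
- by rewrite /shift; lin.
move=> x' y'; rewrite mulFE !shiftE shiftXM shiftYM -!mulA_assoc; congr (bl _ _ _).
by rewrite mulA_comm -mulA_assoc; congr (bl _ _ _); rewrite mulA_comm.
Qed.

(* [fun f => tens (consF f) oneY] is the quasi-shuffle operator R on F: it maps
   w (x) y to (y :: w) (x) 1. *)
Definition consF : F -> L k X := flift (fun p => fgen k (p.2 :: p.1)).

Definition theta (f : F) : A := shift f - incl f.

Lemma theta_linear : linear theta.
Proof.
by apply: linear_fadd; [|apply: linear_fopp]; exact: flift_linear.
Qed.

Lemma theta_consF f : theta (tens (consF f) oneY) = incl f.
Proof.
move: f; apply: freeg_ext.
- apply: (linear_fcomp theta_linear); apply: (linear_fcomp (tens_linearl _)).
  exact: flift_linear.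
- exact: flift_linear.
case=> w y; rewrite /theta shiftE inclE /consF !fliftE.
rewrite [bl mulA _ _]mulA_comm mulA1f pushE /= /incl pushE /= addrC addKr.
exact: blE.
Qed.

(* Forced by theta (sigma a) = a: for u = w' (x) y, shift (R u . b) - incl (R u . b)
   is u . b + R u . b' + u . b'. *)
Fixpoint sigmaC (w : X) (b : B) : F :=
  match w with
  | [::] => fgen k ([::], Some b)
  | y :: w' => fgen k (w, Some b)
     - tens (consF (tens (fgen k w') (mY y (Some b)))) oneY
     - flift (sigmaC w') (actY hB y b)
  end.

(** On the image of [incl] this is the quasi-shuffle operator R; only H (x) C needs the recursion
    [sigmaC]. *)
Definition sigma : A -> F :=
  flift (fun p => match p.2 with
                  | inl y => fgen k (y :: p.1, None)
                  | inr b => sigmaC p.1 b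
                  end).

Lemma sigma_linear : linear sigma.
Proof. exact: flift_linear. Qed.

Lemma theta_sigmaC w b : theta (sigmaC w b) = fgen k (w, inr b).
Proof.
elim: w b => [|y w IHw] b.
  rewrite /theta /= /shift /incl pushE fliftE /= mulA1f.
  rewrite /shiftY (linear_funD (tens_linearr _)) /tens !blE /= addrC addKr //.
rewrite /= !(linear_funB theta_linear) theta_consF.
have -> : theta (flift (sigmaC w) (actY hB y b)) =
    tens (fgen k w) (push inr (actY hB y b)).
  rewrite /push; move: (actY hB y b); apply: freeg_ext.
  - by apply: (linear_fcomp theta_linear); lin.
  - by apply: (linear_fcomp (tens_linearr _)); lin.
  by move=> c; rewrite !fliftE IHw /tens blE.
rewrite inclE.
have -> : fgen k (y :: w, Some b) = tens (fgen k (y :: w)) (fgen k (Some b)) :> F.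
  by rewrite /tens blE.
rewrite /theta shiftE inclE !fliftE /= /shiftY.
rewrite (linear_funD (bl_linearl _ _)) !mulAE !qshf1 mulZ1f.
rewrite (linear_funD (bl_linearr _ _)) !blE !(linear_funD (tens_linearr _)) pushE.
(* Of the four summands of (R u + u)(b + b'), the three subtracted terms cancel all but (R u) b'. *)
rewrite !addrA [LHS](ACl (1*5*3*6*4*7*2)) /= subrr add0r subrr add0r subrr add0r.
exact: blE.
Qed.

Lemma thetaK a : theta (sigma a) = a.
Proof.
move: a; apply: freeg_ext; [|exact: linear_fid|].
  exact: (linear_fcomp theta_linear sigma_linear).
case=> w [y|b]; rewrite /sigma fliftE /=; last exact: theta_sigmaC.
have -> : fgen k (y :: w, None) = tens (consF (fgen k (w, y))) oneY :> F.
  by rewrite /consF fliftE /tens blE.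
by rewrite theta_consF /incl pushE.
Qed.

Lemma sigma_incl f : sigma (incl f) = tens (consF f) oneY.
Proof.
move: f; apply: freeg_ext.
- exact: (linear_fcomp sigma_linear (push_linear _)).
- by apply: (linear_fcomp (tens_linearl _)); exact: flift_linear.
by case=> w y; rewrite /incl pushE /sigma /consF !fliftE /= /tens blE.
Qed.

(** The coefficient of the unit. The kernel of [counit] is the augmentation ideal of F, spanned by
    the basis elements other than the unit. *)
Definition counitX : L k X -> k^o := flift (fun w : X => (nilp w)%:R).
Definition counitY : L k Y -> k^o := flift (fun y : Y => (y == None)%:R).
Definition counit : F -> k^o :=
  flift (fun p : X * Y => (nilp p.1)%:R * (p.2 == None)%:R).

Lemma counitE u a : counit (tens u a) = counitX u * counitY a.
Proof.
rewrite /counit /counitX /counitY /tens; move: u; apply: freeg_ext; first lin.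
  by move=> c u v; rewrite flift_linear mulrDl scalerAl.
move=> x; move: a; apply: freeg_ext; first lin.
  by move=> c u v; rewrite flift_linear mulrDr scalerAr.
by move=> y; rewrite !(blE, fliftE).
Qed.

Lemma counitX_lcons a f : counitX (lcons a f) = 0.
Proof.
rewrite /counitX /lcons; move: a; apply: freeg_ext; [lin..|] => y.
by move: f; apply: freeg_ext; [lin..|] => w; rewrite !(blE, fliftE).
Qed.

(** Makes the kernel of [counit] an ideal, so that it contains sigma(a) sigma(b) and [sigma_theta]
    holds there without correction. *)
Lemma counitM f g : counit (bl mulF f g) = counit f * counit g.
Proof.
have cl : linear counit by exact: flift_linear.
move: f; apply: tens_ext; first lin.
  by move=> c u v; rewrite cl mulrDl scalerAl.
move=> u y; move: g; apply: tens_ext; first lin.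
  by move=> c v w; rewrite cl mulrDr scalerAr.
move=> v z; rewrite mulFE !counitE mulrACA; congr (_ * _); last first.
  rewrite /counitY !fliftE; case: y => [b|]; last by rewrite mulY1f fliftE mul1r.
  case: z => [c|]; last by rewrite mulYf1 fliftE mulr1.
  rewrite blE /= mul0r /push; move: (struct_const _ _ _ _).
  apply: freeg_ext; [lin..|] => d; by rewrite !fliftE.
case: u => [|y' u]; first by rewrite qsh1f /counitX [flift _ oneX]fliftE mul1r.
case: v => [|z' v]; first by rewrite qshf1 /counitX [flift _ oneX]fliftE mulr1.
rewrite -!lconsE qsh_cons !counitX_lcons mul0r.
have cD : {morph counitX : f g / f + g} by apply: linear_funD; exact: flift_linear.
by rewrite !cD !counitX_lcons !addr0.
Qed.

Lemma counit_sigma a : counit (sigma a) = 0.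
Proof.
have cl : linear counit by exact: flift_linear.
have cons0 f : counit (tens (consF f) oneY) = 0.
  rewrite counitE (_ : counitX _ = 0) ?mul0r // /counitX /consF.
  by move: f; apply: freeg_ext; [lin..|] => -[w y]; rewrite !fliftE.
have sigmaC0 w b : counit (sigmaC w b) = 0.
  elim: w b => [|y w IHw] b; first by rewrite /counit fliftE mulr0.
  rewrite /= !(linear_funB cl) cons0 subr0 /counit fliftE mul0r sub0r -/(counit _).
  have -> : counit (flift (sigmaC w) (actY hB y b)) = 0; last exact: oppr0.
  by move: (actY hB y b); apply: freeg_ext; [lin..|] => c; rewrite fliftE IHw.
move: a; apply: freeg_ext; [|exact: linear_fzero|].
  exact: (linear_fcomp cl sigma_linear).
case=> w [y|b]; rewrite /sigma fliftE //=.
by rewrite /counit fliftE mul0r.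
Qed.

(** The unit is killed by theta. Every other basis element is some sigma(a), where [thetaK] and
    [counit_sigma] give the claim. *)
Lemma sigma_theta f : sigma (theta f) = f - counit f *: tens oneX oneY.
Proof.
have cl : linear counit by exact: flift_linear.
move: f; apply: freeg_ext; first exact: (linear_fcomp sigma_linear theta_linear).
  apply: linear_fadd; first exact: linear_fid.
  by apply: linear_fopp => c u v; rewrite cl scalerDl scalerA.
case=> w y; have [/andP[/nilP-> /eqP->]|wy] := boolP (nilp w && (y == None)).
  have -> : fgen k ([::], None) = tens oneX oneY :> F by rewrite /tens blE.
  rewrite counitE /counitX /counitY !fliftE mulr1 scale1r subrr /theta shiftE inclE.
  by rewrite !fliftE mulA1f pushE subrr (linear_fun0 sigma_linear).
suff [a ->] : exists a, fgen k (w, y) = sigma a.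
  by rewrite thetaK counit_sigma scale0r subr0.
case: y w wy => [b|] [|x w] //= _.
- by exists (fgen k ([::], inr b)); rewrite /sigma fliftE.
(* The preimage is found by solving the defining equation of [sigmaC] for its leading term. *)
- exists (fgen k (x :: w, inr b) + incl (tens (fgen k w) (mulY hB x (Some b)))
  + tens (fgen k w) (push inr (actY hB x b))).
  rewrite !(linear_funD sigma_linear) sigma_incl /sigma fliftE /= -/sigma.
  have -> : sigma (tens (fgen k w) (push inr (actY hB x b))) =
      flift (sigmaC w) (actY hB x b).
    rewrite /push /tens; move: (actY hB x b); apply: freeg_ext; last first.
    - by move=> c; rewrite fliftE blE /sigma !fliftE.
    - by lin.
    - by have sl := sigma_linear; lin.
  by rewrite addrAC subrK subrK.
- by exists (fgen k (w, inl x)); rewrite /sigma fliftE.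
Qed.

(** * The Rota-Baxter operator on A *)

Definition rbA (a : A) : A := incl (sigma a).

Lemma rbA_linear : linear rbA.
Proof. exact: (linear_fcomp (push_linear _) sigma_linear). Qed.

(** As S(sigma a) = a + R a, theta(sigma(a) sigma(b)) is (a + R a)(b + R b) - (R a)(R b). Applying
    sigma and then [incl] gives the identity. *)
Lemma rbAM a b : bl mulA (rbA a) (rbA b) =
  rbA (bl mulA (rbA a) b + bl mulA a (rbA b) + bl mulA a b).
Proof.
have S c : shift (sigma c) = c + rbA c by rewrite -{2}(thetaK c) /theta subrK.
have -> : bl mulA (rbA a) b + bl mulA a (rbA b) + bl mulA a b =
    theta (bl mulF (sigma a) (sigma b)).
  rewrite /theta shiftM inclM !S.
  rewrite !(linear_funD (bl_linearr _ _)) !(linear_funD (bl_linearl _ _)).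
  by rewrite [in RHS]addrA addrK [RHS](ACl (2*3*1)).
rewrite /rbA sigma_theta counitM counit_sigma mul0r scale0r subr0 inclM //.
Qed.

Definition rb_model : commRBAlgType k :=
  HB.pack A (isCommRBAlg.Build k A (bl_linearr mulA)
    mulA_comm mulA_assoc rbA_linear rbAM).

Lemma rb_modelM (f g : rb_model) : rbmul f g = bl mulA f g.
Proof. by []. Qed.
Lemma rb_modelR (f : rb_model) : rbop f = rbA f.
Proof. by []. Qed.
End RBModel.

(** * Independence *)

Section DualWords.
Variables (k : fieldType) (C : postCommAlgType k) (B : set C).
Hypothesis hB : linear_basis B.

Local Notation Y := (option B).
Local Notation Z := (option B + B)%type.
Local Notation X := (seq Y).
Local Notation F := (L k (X * Y)%type).
Local Notation A := (L k (X * Z)%type).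
Local Notation oneX := (fgen k ([::] : X)).
Local Notation oneY := (fgen k (None : Y)).
Local Notation oneZ := (fgen k (inl None : Z)).
Local Notation model := (rb_model hB).

Definition model_incl (c : C) : model := tens oneX (eC hB c).

(** Since sigma(c') = c, the operation R(x)y on the copy of C is the action of D on C, that is
    [psucc]. *)
Lemma rbop_model_incl c : rbop (model_incl c) = tens oneX (eD hB c).
Proof.
rewrite rb_modelR /rbA /model_incl /eD /eC /eY; move: (coordB hB c) => u.
have sl := sigma_linear hB; have il : linear (@incl k C B) := push_linear _.
rewrite /push /tens; move: u; apply: freeg_ext; [lin..|] => b.
by rewrite !(fliftE, blE) /sigma fliftE /= /incl pushE.
Qed.

Lemma model_incl_hom : post_hom (model_incl : C -> rbpost model).
Proof.
split.
- apply: (linear_fcomp (tens_linearr _)); apply: (linear_fcomp (push_linear _)).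
  exact: coordB_linear.
- move=> x y.
  change (model_incl (psucc x y) = rbmul (rbop (model_incl x)) (model_incl y)).
  by rewrite rbop_model_incl rb_modelM mulAE qsh1f mulZ_DC.
- move=> x y.
  change (model_incl (pperp x y) = rbmul (model_incl x) (model_incl y)).
  by rewrite rb_modelM mulAE qsh1f mulZ_CC.
Qed.

Definition model_gen (b : B) : model := model_incl (val b).

Lemma model_genE b : model_gen b = tens oneX (fgen k (inr b)).
Proof. by rewrite fgenC. Qed.

Definition model_word : stdword B -> model := stdword_val model_gen.

Lemma model_word1 b : model_word (SMon (monomial1 b)) = fgen k ([::], inr b).
Proof. by rewrite /model_word /= monomial_val1 model_genE /tens blE. Qed.

Lemma model_word2 u : model_word (SOp u) = incl (sigma hB (model_word u)).
Proof. by []. Qed.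

(** By [sigma_incl], the outer R acts on [incl F] by prepending a letter, and its value has the unit
    as right factor. *)
Lemma model_word3 u b : model_word (SOpMul (SOp u) (monomial1 b)) =
  tens (consF (sigma hB (model_word u))) (fgen k (inr b)).
Proof.
rewrite /model_word /= monomial_val1 model_genE rb_modelM !rb_modelR /rbA.
by rewrite sigma_incl inclE pushE mulAE qshf1 mulZ1f.
Qed.

(** E-words of types 2, 3 and 1 lie in three complementary parts of A: H (x) D^#, nonempty words (x)
    C, and 1 (x) C. [projF], [projC] and [coefC] read these parts; [projC] also undoes [consF]. *)
Definition projF : A -> F :=
  flift (fun p => if p.2 is inl y then fgen k (p.1, y) else 0).

Definition projC (b : B) : A -> F :=
  flift (fun p => match p with
                  | (y :: w, inr c) => if c == b then fgen k (w, y) else 0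
                  | _ => 0
                  end).

Definition coefC (b : B) : A -> k^o :=
  flift (fun p => (p == ([::], inr b))%:R).

Lemma projF_incl f : projF (incl f) = f.
Proof.
rewrite /projF /incl /push; move: f; apply: freeg_ext; [lin..|] => -[w y].
by rewrite !fliftE.
Qed.

Lemma projF_C u b : projF (tens u (fgen k (inr b))) = 0.
Proof.
rewrite /projF /tens; move: u; apply: freeg_ext; [lin..|] => w.
by rewrite blE fliftE.
Qed.

Lemma projC_incl b f : projC b (incl f) = 0.
Proof.
rewrite /projC /incl /push; move: f; apply: freeg_ext; [lin..|] => -[[|x w] y];
by rewrite !fliftE.
Qed.

Lemma projC_cons b c f :
  projC b (tens (consF f) (fgen k (inr c))) = if c == b then f else 0.
Proof.
rewrite /projC /tens /consF.
case: ifP => cb; move: f; apply: freeg_ext; try lin;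
by case=> w y; rewrite !(fliftE, blE) cb.
Qed.

Lemma coefC_incl b f : coefC b (incl f) = 0.
Proof.
rewrite /coefC /incl /push; move: f; apply: freeg_ext; [lin..|] => -[w y].
by rewrite !fliftE xpair_eqE andbF.
Qed.

Lemma coefC_cons b f z : coefC b (tens (consF f) (fgen k z)) = 0.
Proof.
rewrite /coefC /tens /consF; move: f; apply: freeg_ext; [lin..|] => -[w y].
by rewrite !(fliftE, blE).
Qed.

(** Induction on w: the functional of R(u) or R^2(u)b is a projection, then theta to undo sigma,
    then the functional of u. The projection kills the words of other types. *)
Lemma dual_word w : Eword w -> exists l : A -> k^o, [/\ linear l,
  l (model_word w) = 1 & forall v, Eword v -> v <> w -> l (model_word v) = 0].
Proof.
have tl := theta_linear hB.
elim=> {w} [b|u _ [l [ll l1 l0]]|u b _ [l [ll l1 l0]]].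
- exists (coefC b); split.
  + exact: flift_linear.
  + by rewrite model_word1 /coefC fliftE eqxx.
  + move=> _ [c|u _|u c _] ne.
    * rewrite model_word1 /coefC fliftE; case: eqP => // -[cb].
      by case: ne; rewrite cb.
    * by rewrite model_word2 coefC_incl.
    * by rewrite model_word3 coefC_cons.
- have pl : linear projF by exact: flift_linear.
  exists (fun a => l (theta hB (projF a))); split; first by lin.
    by rewrite model_word2 projF_incl thetaK.
  move=> _ [c|v Ev|v c _] ne.
  + have -> : model_word (SMon (monomial1 c)) = tens oneX (fgen k (inr c)).
      by rewrite model_word1 /tens blE.
    by rewrite projF_C !linear_fun0.
  + by rewrite model_word2 projF_incl thetaK l0 // => uv; apply: ne; rewrite uv.
  + by rewrite model_word3 projF_C !linear_fun0.
- have pl : linear (projC b) by exact: flift_linear.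
  exists (fun a => l (theta hB (projC b a))); split; first by lin.
    by rewrite model_word3 projC_cons eqxx thetaK.
  move=> _ [c|v Ev|v c Ev] ne.
  + by rewrite model_word1 /projC fliftE !linear_fun0.
  + by rewrite model_word2 projC_incl !linear_fun0.
  + rewrite model_word3 projC_cons; case: eqP => [cb|_]; last by rewrite !linear_fun0.
    by rewrite thetaK l0 // => uv; apply: ne; rewrite uv cb.
Qed.

Lemma URB_word2 u : URB_word (SOp u) = rbop (URB_word u) :> URB B.
Proof. by rewrite /URB_word; have [_ _ <-] := @URB_proj_hom k C B. Qed.

Lemma URB_word1 b : URB_word (SMon (monomial1 b)) = URB_incl hB (val b).
Proof. by rewrite /URB_word /= monomial_val1 URB_incl_gen. Qed.

Lemma URB_word3 u b : URB_word (SOpMul u (monomial1 b)) =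
  rbmul (rbop (URB_word u)) (URB_incl hB (val b)) :> URB B.
Proof.
have [_ pm pr] := @URB_proj_hom k C B.
by rewrite /URB_word /= monomial_val1 URB_incl_gen pm pr.
Qed.

(** The functionals of the model are pulled back along the homomorphism given by the universal
    property. *)
Lemma dual_URB_word w : Eword w -> exists l : URB B -> k^o, [/\ linear l,
  l (URB_word w) = 1 & forall v, Eword v -> v <> w -> l (URB_word v) = 0].
Proof.
have [h [[hl hm hr] hE _]] := URB_universal hB model_incl_hom.
have hW v : Eword v -> h (URB_word v) = model_word v.
  elim=> {v} [b|u _ IHu|u b _ IHu].
  - by rewrite URB_word1 hE /model_word /= monomial_val1.
  - by rewrite URB_word2 hr IHu.
  - by rewrite URB_word3 URB_word2 hm !hr hE IHu /model_word /= monomial_val1.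
move=> Ew; have [l [ll l1 l0]] := dual_word Ew.
exists (fun x => l (h x)); split; first by lin.
- by rewrite hW.
- by move=> v Ev vw; rewrite hW // l0.
Qed.

End DualWords.

(** * Spanning *)

Section LinearSpan.
Variables (k : fieldType) (V : lmodType k) (S : set V).

Inductive lspan : V -> Prop :=
| lspan0 : lspan 0
| lspan_cons a x v : S x -> lspan v -> lspan (a *: x + v).

Lemma lspan_lin a u v : lspan u -> lspan v -> lspan (a *: u + v).
Proof.
move=> su sv; elim: su => [|b x w Sx _ IHw]; first by rewrite scaler0 add0r.
by rewrite scalerDr scalerA -addrA; exact: lspan_cons.
Qed.

Lemma lspan_sum (J : Type) (s : seq J) (c : J -> k) (v : J -> V) :
  (forall i, S (v i)) -> lspan (\sum_(i <- s) c i *: v i).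
Proof.
move=> Sv; elim: s => [|i s IHs]; first by rewrite big_nil; exact: lspan0.
by rewrite big_cons; exact: lspan_cons.
Qed.

(** Coefficients in [spanning] are a function of the vector, so repeated vectors must be merged;
    this is why [s] is kept duplicate-free. *)
Lemma spanning_lspan : (forall v, lspan v) -> spanning S.
Proof.
move=> all_span v; suff [s [c [_ sS ->]]] : exists (s : seq V) (c : V -> k),
  [/\ uniq s, forall x, x \in s -> S x & v = \sum_(x <- s) c x *: x] by exists s, c.
elim: {v}(all_span v) => [|a x v Sx _ [s [c [us sS ->]]]].
  by exists [::], (fun=> 0); rewrite big_nil.
have [xs|xs] := boolP (x \in s).
  exists s, (fun y => if y == x then a + c x else c y); split=> //.
  rewrite (bigD1_seq x) //= [RHS](bigD1_seq x) //= eqxx scalerDl -addrA.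
  by congr (_ + (_ + _)); apply: eq_bigr => y /negPf ->.
exists (x :: s), (fun y => if y == x then a else c y); split=> /=.
- by rewrite xs.
- by move=> y; rewrite inE => /orP[/eqP->|/sS].
rewrite big_cons eqxx; congr (_ + _); rewrite !big_seq; apply: eq_bigr => y ys.
by case: eqP => // yx; rewrite -yx ys in xs.
Qed.

End LinearSpan.

(** * Two descriptions of one span and its closure under products *)

Section EnvelopingSpan.
Variables (k : fieldType) (C : postCommAlgType k) (A : commRBAlgType k).
Variable f : C -> A.
Hypothesis f_hom : post_hom (f : C -> rbpost A).

Definition rstar (x y : A) : A := @pstar k (rbpost A) x y.

Lemma rstarE x y : rstar x y = rbmul (rbop x) y + rbmul (rbop y) x + rbmul x y.
Proof. by []. Qed.

Lemma rstarC : commutative rstar.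
Proof. exact: (@pstarC k (rbpost A)). Qed.

Lemma rstarA : associative rstar.
Proof. exact: (@pstarA k (rbpost A)). Qed.

Lemma rstar_linearr x : linear (rstar x).
Proof. exact: (@pstar_linearr k (rbpost A)). Qed.

Lemma rstar_linearl y : linear (fun x => rstar x y).
Proof. exact: (@pstar_linearl k (rbpost A)). Qed.

Lemma rbop_rstar x y : rbop (rstar x y) = rbmul (rbop x) (rbop y).
Proof. by rewrite rbopM rstarE (rbmulC (rbop y)). Qed.

Lemma hom_linear : linear f.
Proof. by have [] := f_hom. Qed.

Lemma hom_succ c d : f (psucc c d) = rbmul (rbop (f c)) (f d).
Proof. by have [_ fs _] := f_hom; exact: fs. Qed.

Lemma hom_perp c d : f (pperp c d) = rbmul (f c) (f d).
Proof. by have [_ _ fp] := f_hom; exact: fp. Qed.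

Lemma hom_star c d : f (pstar c d) = rstar (f c) (f d).
Proof. by rewrite /pstar !(linear_funD hom_linear) !hom_succ hom_perp. Qed.

Lemma rbmul_linearl (y : A) : linear (fun x => rbmul x y).
Proof. by move=> a u v; rewrite rbmulDl rbmulZl. Qed.

(** Spanned by E-words whose letters are arbitrary elements of C; 0 enters as f 0. *)
Inductive Espan : A -> Prop :=
| Espan_lin a x y : Espan x -> Espan y -> Espan (a *: x + y)
| Espan_C c : Espan (f c)
| Espan_op x : Espan x -> Espan (rbop x)
| Espan_op2 x c : Espan x -> Espan (rbmul (rbop (rbop x)) (f c)).

(* The index bounds the number of applications of R; it makes the replacement of
   R(x) * c by R(R(x)) c + R(x * c) + R(x) c terminate. *)
Inductive Fspan : nat -> A -> Prop :=
| Fspan_lin n a x y : Fspan n x -> Fspan n y -> Fspan n (a *: x + y)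
| Fspan_C n c : Fspan n (f c)
| Fspan_op n x : Fspan n x -> Fspan n.+1 (rbop x)
| Fspan_star n x c : Fspan n x -> Fspan n.+1 (rstar (rbop x) (f c)).

Lemma EspanD x y : Espan x -> Espan y -> Espan (x + y).
Proof. by move=> Ex Ey; rewrite -[x]scale1r; exact: Espan_lin. Qed.

(** The index does not grow, because (R(x) * d) * c = R(x) * (d * c) merges the two factors from
    C. *)
Lemma Fspan_starC n x c : Fspan n x -> Fspan n (rstar x (f c)).
Proof.
move=> Nx; elim: Nx c => {n x} [n a x y _ IHx _ IHy|n d|n x Nx _|n x d Nx _] c.
- by rewrite rstar_linearl; apply: Fspan_lin.
- by rewrite -hom_star; exact: Fspan_C.
- exact: Fspan_star.
- by rewrite -rstarA -hom_star; exact: Fspan_star.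
Qed.

Lemma Fspan_Espan n x : Fspan n x ->
  Espan x /\ forall c, Espan (rbmul (rbop x) (f c)).
Proof.
have [m] := ubnP n; elim: m n x => // m IHm n x lt_nm Nx.
elim: Nx lt_nm => {n x} [n a x y _ IHx _ IHy|n d|n x Nx IHx|n x d Nx IHx] lt_nm.
- have [Ex Rx] := IHx lt_nm; have [Ey Ry] := IHy lt_nm.
  split=> [|c]; first exact: Espan_lin.
  by rewrite rbop_linear rbmul_linearl; apply: Espan_lin.
- by split=> [|c]; [|rewrite -hom_succ]; exact: Espan_C.
- have [Ex Rx] := IHx (ltnW lt_nm).
  by split=> [|c]; [apply: Espan_op | apply: Espan_op2].
- have [Ex Rx] := IHx (ltnW lt_nm).
  (* Expanding R(x) * d produces R(x * d); as x * d has the smaller index n, the outer induction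
     covers it. *)
  have [Es _] := IHm n (rstar x (f d)) lt_nm (Fspan_starC d Nx).
  split=> [|c].
    rewrite rstarE -rbop_rstar rstarC; apply: EspanD => //.
    by apply: EspanD; [apply: Espan_op2 | apply: Espan_op].
  by rewrite rbop_rstar -rbmulA -hom_succ; apply: Espan_op2.
Qed.

Lemma Fspan_le n m x : (n <= m)%N -> Fspan n x -> Fspan m x.
Proof.
move=> le_nm Nx; elim: Nx m le_nm => {n x}
  [n a x y _ IHx _ IHy|n d|n x _ IHx|n x d _ IHx] m le_nm.
- by apply: Fspan_lin; [apply: IHx | apply: IHy].
- exact: Fspan_C.
- by case: m le_nm => // m le_nm; apply/Fspan_op/IHx.
- by case: m le_nm => // m le_nm; apply/Fspan_star/IHx.
Qed.

Definition Fall x := exists n, Fspan n x.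

Lemma Fall_lin a x y : Fall x -> Fall y -> Fall (a *: x + y).
Proof.
move=> [n Nx] [m Ny]; exists (maxn n m); apply: Fspan_lin.
  exact: Fspan_le (leq_maxl n m) Nx.
exact: Fspan_le (leq_maxr n m) Ny.
Qed.

Lemma FallD x y : Fall x -> Fall y -> Fall (x + y).
Proof. by move=> Fx Fy; rewrite -[x]scale1r; exact: Fall_lin. Qed.

Lemma FallB x y : Fall x -> Fall y -> Fall (x - y).
Proof. by move=> Fx Fy; rewrite addrC -scaleN1r; exact: Fall_lin. Qed.

Lemma Fall_C c : Fall (f c).
Proof. by exists 0%N; exact: Fspan_C. Qed.

Lemma Fall_op x : Fall x -> Fall (rbop x).
Proof. by case=> n Nx; exists n.+1; exact: Fspan_op. Qed.

Lemma Fall_star x c : Fall x -> Fall (rstar (rbop x) (f c)).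
Proof. by case=> n Nx; exists n.+1; exact: Fspan_star. Qed.

Lemma Fall_starC x c : Fall x -> Fall (rstar x (f c)).
Proof. by case=> n Nx; exists n; exact: Fspan_starC. Qed.

Lemma Fall_ind (P : A -> Prop) :
    (forall a x y, P x -> P y -> P (a *: x + y)) ->
    (forall c, P (f c)) ->
    (forall x, Fall x -> P x -> P (rbop x)) ->
    (forall x c, Fall x -> P x -> P (rstar (rbop x) (f c))) ->
  forall x, Fall x -> P x.
Proof.
move=> Pl Pc Pop Ps x [n]; elim=> {n x} [n a x y _ Px _ Py|n c|n x Nx Px|n x c Nx Px].
- exact: Pl.
- exact: Pc.
- by apply: Pop => //; exists n.
- by apply: Ps => //; exists n.
Qed.

(** Rests on R(u) * R(v) = R(R(u) * v) + R(R(v) * u) + R(u * v). Factors from C are moved outside by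
    associativity and absorbed by [Fall_starC]. *)
Lemma Fall_rstar x y : Fall x -> Fall y -> Fall (rstar x y).
Proof.
(* The induction hypothesis on u is a premise, so that [opx] serves both for R(u) and for R(u) *
   c. *)
have opx u : Fall u -> (forall v, Fall v -> Fall (rstar u v)) ->
    forall v, Fall v -> Fall (rstar (rbop u) v).
  move=> Fu uF; have opop v : Fall v -> Fall (rstar (rbop u) v) ->
      Fall (rstar (rbop u) (rbop v)).
    move=> Fv Fuv; rewrite rstarE -!rbop_rstar (rstarC (rbop v)).
    by apply: FallD; [apply: FallD|]; apply: Fall_op => //; apply: uF => //;
      exact: Fall_op.
  apply: Fall_ind => [a v v' Fv Fv'|c|v Fv Fuv|v c Fv Fuv].
  - by rewrite rstar_linearr; exact: Fall_lin.
  - exact: Fall_star.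
  - exact: opop.
  - by rewrite rstarA; apply: Fall_starC; exact: opop.
move=> Fx; elim/Fall_ind: x / Fx y => [a x x' IHx IHx'|c|x Fx IHx|x c Fx IHx] y Fy.
- by rewrite rstar_linearl; apply: Fall_lin; [apply: IHx | apply: IHx'].
- by rewrite rstarC; exact: Fall_starC.
- exact: opx.
- by rewrite rstarC rstarA (rstarC y); apply: Fall_starC; exact: opx.
Qed.

(** R^2(u)c is R(u) * c - R(u * c) - R(u)c. The two claims go together, since the first for R(u) is
    the second for u. *)
Lemma Fall_rbop_C x : Fall x -> forall c,
  Fall (rbmul (rbop x) (f c)) /\ Fall (rbmul (rbop (rbop x)) (f c)).
Proof.
have op2 u c : Fall u -> Fall (rbmul (rbop u) (f c)) ->
    Fall (rbmul (rbop (rbop u)) (f c)).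
  move=> Fu Fuc.
  have -> : rbmul (rbop (rbop u)) (f c) =
      rstar (rbop u) (f c) - rbop (rstar u (f c)) - rbmul (rbop u) (f c).
    by rewrite rstarE rstarC rbop_rstar addrAC addrK addrK.
  apply: FallB => //; apply: FallB; first exact: Fall_star.
  exact/Fall_op/Fall_starC.
move: x; apply: Fall_ind => [a x y Tx Ty c|d c|x Fx Tx c|x d Fx Tx c].
- have [Fx Fx2] := Tx c; have [Fy Fy2] := Ty c.
  by split; rewrite !rbop_linear rbmul_linearl; apply: Fall_lin.
- have Fdc : Fall (rbmul (rbop (f d)) (f c)) by rewrite -hom_succ; exact: Fall_C.
  by split=> //; apply: op2 => //; exact: Fall_C.
- have [_ Fx2] := Tx c; split=> //; apply: op2 => //; exact: Fall_op.
- have Fxc : Fall (rbmul (rbop (rstar (rbop x) (f d))) (f c)).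
    by rewrite rbop_rstar -rbmulA -hom_succ; have [] := Tx (psucc d c).
  by split=> //; apply: op2 => //; exact: Fall_star.
Qed.

(** Carries closure under [rstar], proved for [Fall], over to the span of the E-words. *)
Lemma Espan_Fall x : Espan x <-> Fall x.
Proof.
split=> [|[n /Fspan_Espan[]//]].
elim=> {x} [a x y _ Fx _ Fy|c|x _ Fx|x c _ Fx].
- exact: Fall_lin.
- exact: Fall_C.
- exact: Fall_op.
- by have [] := Fall_rbop_C Fx c.
Qed.

Lemma Espan_opC x c : Espan x -> Espan (rbmul (rbop x) (f c)).
Proof. by move=> /Espan_Fall[n /Fspan_Espan[_]]. Qed.

Lemma Espan_opop x y : Espan x -> Espan y -> Espan (rbmul (rbop x) (rbop y)).
Proof.
move=> /Espan_Fall Fx /Espan_Fall Fy; rewrite -rbop_rstar.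
exact/Espan_op/Espan_Fall/Fall_rstar.
Qed.

Lemma Espan_opopC x y c : Espan x -> Espan y ->
  Espan (rbmul (rbmul (rbop x) (rbop y)) (f c)).
Proof.
move=> /Espan_Fall Fx /Espan_Fall Fy; rewrite -rbop_rstar.
exact/Espan_opC/Espan_Fall/Fall_rstar.
Qed.

(** Factors from C combine by [pperp] and values of R by R(x)R(y) = R(x * y), so products of words
    become elements of C, R(z) or R(z)c with z in the span. *)
Lemma Espan_mul x y : Espan x -> Espan y -> Espan (rbmul x y).
Proof.
move=> Ex Ey; elim: Ex => {x} [a x x' _ IHx _ IHx'|c|x Ex _|x c Ex _].
- by rewrite rbmul_linearl; exact: Espan_lin.
- elim: Ey => {y} [a y y' _ IHy _ IHy'|d|y Ey _|y d Ey _].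
  + by rewrite rbmul_linear; exact: Espan_lin.
  + by rewrite -hom_perp; exact: Espan_C.
  + by rewrite rbmulC; exact: Espan_opC.
  + by rewrite rbmulC -rbmulA -hom_perp; exact: Espan_op2.
- elim: Ey => {y} [a y y' _ IHy _ IHy'|d|y Ey _|y d Ey _].
  + by rewrite rbmul_linear; exact: Espan_lin.
  + exact: Espan_opC.
  + exact: Espan_opop.
  + by rewrite rbmulA; apply: Espan_opopC => //; exact: Espan_op.
- elim: Ey => {y} [a y y' _ IHy _ IHy'|d|y Ey _|y d Ey _].
  + by rewrite rbmul_linear; exact: Espan_lin.
  + by rewrite -rbmulA -hom_perp; exact: Espan_op2.
  + rewrite rbmulC rbmulA; apply: Espan_opopC => //; exact: Espan_op.
  + rewrite -rbmulA (rbmulC (f c)) -rbmulA rbmulA -hom_perp.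
    by apply: Espan_opopC; exact: Espan_op.
Qed.

End EnvelopingSpan.

Lemma Espan_URB (k : fieldType) (C : postCommAlgType k) (B : set C)
  (hB : linear_basis B) (x : URB B) : Espan (URB_incl hB) x.
Proof.
have ih := URB_incl_hom hB; have [pl pm pr] := @URB_proj_hom k C B.
have E0 : Espan (URB_incl hB) (0 : URB B).
  by rewrite -(linear_fun0 (URB_incl_linear hB)); exact: Espan_C.
elim/rb_proj_surj: x => x; elim/freeRB_surj: x => t.
rewrite -[rb_proj _ _]/(URB_proj _).
elim: t => [b||t IHt u IHu|a t IHt|t IHt u IHu|t IHt].
- by rewrite -[freeRB_class _]/(freeRB_gen k b) -(URB_incl_gen hB); exact: Espan_C.
- by rewrite -[freeRB_class _]/(0 : freeRB k B) (linear_fun0 pl).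
- by rewrite -freeRB_addE (linear_funD pl); exact: EspanD.
- by rewrite -freeRB_scaleE -[_ *: _]addr0 pl (linear_fun0 pl); exact: Espan_lin.
- by rewrite -freeRB_mulE pm; exact: Espan_mul.
- by rewrite -freeRB_opE pr; exact: Espan_op.
Qed.

(** * Injectivity, independence and spanning of the E-words *)

Theorem theorem3 (k : fieldType) (C : postCommAlgType k) (B : set C)
    (hB : linear_basis B) :
  set_inj (@Eword B) (@URB_word k C B) /\
  linear_basis (@URB_word k C B @` @Eword B).
Proof.
have URB_inj : set_inj (@Eword B) (@URB_word k C B).
  move=> u v /set_mem Eu /set_mem Ev uv; apply: contrapT => ne.
  have [l [_ l1 l0]] := dual_URB_word hB Eu.
  by have := l0 v Ev (nesym ne); rewrite -uv l1 => /eqP; rewrite oner_eq0.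
split=> //; split.
  move=> s c us sE sum0 x xs; have [w Ew wx] := sE x xs.
  (* The functional dual to the word behind x isolates the coefficient of x. *)
  have [l [ll l1 l0]] := dual_URB_word hB Ew.
  have := linear_fun0 ll; rewrite -[in l 0]sum0 (Defs.linear_sum ll).
  rewrite (bigD1_seq x) //= -{2}wx l1 big_seq_cond big1 => [|y /andP[ys yx]].
    by rewrite addr0 => <-; rewrite [RHS]mulr1.
  have [v Ev vy] := sE y ys; rewrite -vy l0 ?scaler0 // => vw.
  by rewrite -vy vw wx eqxx in yx.
apply: spanning_lspan => x.
elim: (Espan_URB hB x) => {x} [a x y _ sx _ sy|c|x _ sx|x c _ sx].
- exact: lspan_lin.
- have [s [d ->]] := val_comb_total hB c; rewrite /val_comb.
  rewrite (Defs.linear_sum (URB_incl_linear hB)); apply: lspan_sum => b.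
  exists (SMon (monomial1 b)); [exact: Eword1 | exact: URB_word1].
- elim: sx => [|a _ v [w Ew <-] _ IHv]; first by rewrite rbop0; exact: lspan0.
  rewrite rbop_linear -URB_word2; apply: lspan_cons => //.
  by exists (SOp w) => //; exact: Eword2.
(* R^2(x)c is bilinear in x and c; expanding c over B and x over E-words leaves words of type 3. *)
- have [s [d ->]] := val_comb_total hB c; rewrite /val_comb.
  rewrite (Defs.linear_sum (URB_incl_linear hB)) (Defs.linear_sum (rbmul_linear _)).
  elim: s => [|b s IHs]; first by rewrite big_nil; exact: lspan0.
  rewrite big_cons; apply: lspan_lin => {IHs s} //.
  elim: sx => [|a _ v [w Ew <-] _ IHv].
    by rewrite !rbop0 rbmulC rbmul0r; exact: lspan0.
  rewrite !rbop_linear rbmul_linearl -URB_word2 -URB_word3; apply: lspan_cons => //.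
  by exists (SOpMul (SOp w) (monomial1 b)) => //; exact: Eword3.
Qed.
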